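(* Let $d>2$ be an integer and $-1\le\eta\le-\frac2d$. Then the two-copy relative entropy of entanglement $E_R^2(W_{\eta,d}):=\frac12E_R(W_{\eta,d}^{\otimes2})$ of the Werner state $W_{\eta,d}$ is $$E_R^2(W_{\eta,d})=\frac{(1-\eta)^2}{8}\log_2\frac{(1-\eta)^2}{4x_0}+\frac{(1-\eta)(1+\eta)}{4}\log_2\frac{(1-\eta)(1+\eta)}{2x_1}+\frac{(1+\eta)^2}{8}\log_2\frac{(1+\eta)^2}{4(1-x_0-x_1)},$$ where $$x_0=\frac{d^2(\eta^2+1)+\sqrt\theta-2d(\eta-2)-2\eta^2-2}{8d(d+2)},\qquad x_1=-\frac{d^2(\eta^2-3)+\sqrt\theta-2d\eta-2\eta^2+6}{4(d^2-4)},$$ $$\theta=d^4(\eta^2+1)^2-4d^3\eta(\eta^2-3)-4d^2(\eta^4+3\eta^2-1)+8d\eta(\eta^2-3)+4(\eta^2+1)^2.$$ Moreover, this pair $(x_0,x_1)$ minimises the function $$(u,v)\mapsto\frac{(1-\eta)^2}{8}\log_2\frac{(1-\eta)^2}{4u}+\frac{(1-\eta)(1+\eta)}{4}\log_2\frac{(1-\eta)(1+\eta)}{2v}+\frac{(1+\eta)^2}{8}\log_2\frac{(1+\eta)^2}{4(1-u-v)}$$ over all $(u,v)$ with $u,v\ge0$, $u+v\le1$, $1-2v\ge0$, $(d-1)-2du+(2-d)v\ge0$ and $(d-1)^2+4du+2(d-1)v\ge0$.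
   Context: Werner state: for $\eta\in[-1,1]$, $W_{\eta,d}=\frac{(d-\eta)\mathbb{I}+(d\eta-1)\mathbb{F}}{d^3-d}$ on $\mathbb{C}^d\otimes\mathbb{C}^d$, where $\mathbb{I}$ is the identity and $\mathbb{F}=\sum_{i,j}|ij\rangle\langle ji|$ the flip operator. Relative entropy: $S(\rho\|\sigma)=\mathrm{Tr}(\rho\log_2\rho-\rho\log_2\sigma)$. Relative entropy of entanglement: $E_R(\rho)=\inf_{\sigma\ \mathrm{separable}}S(\rho\|\sigma)$; for the two-copy state $W_{\eta,d}^{\otimes2}$ on $A_1B_1A_2B_2$ separability is with respect to the bipartition $A_1A_2|B_1B_2$. Convention: terms of the form $0\log_2(0/x)$ (including $x=0$) are $0$. *)

(* Defs.v *)
From mathcomp Require Import all_boot all_order all_algebra.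
From mathcomp Require Import spectral sesquilinear.
From mathcomp Require Import all_classical all_reals ereal exp.
From mathcomp.real_closed Require Import complex mxtens.

Set Implicit Arguments.
Unset Strict Implicit.
Unset Printing Implicit Defensive.

Import Order.TTheory GRing.Theory Num.Theory.

Local Open Scope ring_scope.
Local Open Scope complex_scope.
Local Open Scope sesquilinear_scope.

(* Operators on C^n are matrices over R[i]; C^m (x) C^n is C^(m * n), the basis
   vector |i>|j> having index mxtens_index (i, j). *)

Section Operators.
Context {R : realType}.
Local Notation C := R[i].

(* A row vector v plays the role of a bra <x|, so v *m A *m v^t* is <x|A|x>. *)
Definition psdmx n (A : 'M[C]_n) : Prop :=
  A \is hermsymmx /\ forall v : 'rV[C]_n, 0 <= (v *m A *m v^t*) 0 0.

Definition density_matrix n (A : 'M[C]_n) : Prop := psdmx A /\ \tr A = 1.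

(* ln vanishes on nonpositive reals; in particular log2 0 = 0. *)
Definition log2 (x : R) : R := ln x / ln 2.

(* Spectral functional calculus, meant for Hermitian A, where
   A = P^-1 *m diag_mx (spectral_diag A) *m P with P = spectralmx A unitary and
   spectral_diag A real. *)
Definition funmx (f : R -> R) n (A : 'M[C]_n) : 'M[C]_n :=
  invmx (spectralmx A)
    *m diag_mx (map_mx (fun z : C => (f (complex.Re z))%:C) (spectral_diag A))
    *m spectralmx A.

Definition log2mx n (A : 'M[C]_n) : 'M[C]_n := funmx log2 A.

(* Quantum relative entropy S(rho || sigma) = Tr (rho log rho - rho log sigma),
   equal to +oo unless supp rho is contained in supp sigma (for Hermitian
   matrices: inclusion of the row spaces).  When it is contained, the value 0
   given to log2 0 implements the convention 0 log 0 = 0. *)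
Definition relative_entropy n (rho sigma : 'M[C]_n) : \bar R :=
  if (rho <= sigma)%MS
  then (complex.Re (\tr (rho *m log2mx rho - rho *m log2mx sigma)))%:E
  else +oo%E.

Definition separable_state m n (sigma : 'M[C]_(m * n)) : Prop :=
  exists (K : nat) (p : 'I_K -> R)
         (rho : 'I_K -> 'M[C]_m) (tau : 'I_K -> 'M[C]_n),
    [/\ forall k, 0 <= p k,
        \sum_k p k = 1,
        forall k, density_matrix (rho k),
        forall k, density_matrix (tau k) &
        sigma = \sum_k (p k)%:C *: (rho k *t tau k)].

Definition entanglement_relative_entropy m n (rho : 'M[C]_(m * n)) : \bar R :=
  ereal_inf [set relative_entropy rho sigma |
             sigma in [set s | separable_state (m := m) (n := n) s]]%classic.

(* Sends the index of |a1 a2>|b1 b2> in (A1 A2)(B1 B2) to the index of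
   |a1 b1>|a2 b2> in (A1 B1)(A2 B2). *)
Definition regroup m n (k : 'I_((m * m) * (n * n))) : 'I_((m * n) * (m * n)) :=
  let: (a, b) := mxtens_unindex k in
  let: (a1, a2) := mxtens_unindex a in
  let: (b1, b2) := mxtens_unindex b in
  mxtens_index (mxtens_index (a1, b1), mxtens_index (a2, b2)).

(* rho (x) rho as an operator on (A1 A2) (x) (B1 B2). *)
Definition two_copies m n (rho : 'M[C]_(m * n)) : 'M[C]_((m * m) * (n * n)) :=
  mxsub (@regroup m n) (@regroup m n) (rho *t rho).

Definition two_copy_entanglement_relative_entropy m n (rho : 'M[C]_(m * n)) : \bar R :=
  ((2^-1)%:E * entanglement_relative_entropy (two_copies rho))%E.

(* F = sum_(i,j) |ij><ji| *)
Definition flip d : 'M[C]_(d * d) :=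
  \sum_(i < d) \sum_(j < d)
    delta_mx (mxtens_index (i, j)) (mxtens_index (j, i)).

Definition werner (eta : R) (d : nat) : 'M[C]_(d * d) :=
  ((d%:R ^+ 3 - d%:R)^-1)%:C *:
    ((d%:R - eta)%:C *: 1%:M + (d%:R * eta - 1)%:C *: flip d).

End Operators.

Section Formula.
Context {R : realType}.

Definition werner_theta (d eta : R) : R :=
  d ^+ 4 * (eta ^+ 2 + 1) ^+ 2 - 4 * d ^+ 3 * eta * (eta ^+ 2 - 3)
  - 4 * d ^+ 2 * (eta ^+ 4 + 3 * eta ^+ 2 - 1)
  + 8 * d * eta * (eta ^+ 2 - 3) + 4 * (eta ^+ 2 + 1) ^+ 2.

Definition werner_x0 (d eta : R) : R :=
  (d ^+ 2 * (eta ^+ 2 + 1) + Num.sqrt (werner_theta d eta) - 2 * d * (eta - 2)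
   - 2 * eta ^+ 2 - 2) / (8 * d * (d + 2)).

Definition werner_x1 (d eta : R) : R :=
  - ((d ^+ 2 * (eta ^+ 2 - 3) + Num.sqrt (werner_theta d eta) - 2 * d * eta
      - 2 * eta ^+ 2 + 6) / (4 * (d ^+ 2 - 4))).

Definition elog2 (x : \bar R) : \bar R := (lne x / (ln 2)%:E)%E.

(* The arithmetic of \bar R yields the intended boundary values: for a, b > 0,
   a * elog2 (b / 0) = +oo, and 0 * elog2 (0 / x) = 0, also for x = 0. *)
Definition objective (eta u v : R) : \bar R :=
  (((1 - eta) ^+ 2 / 8)%R%:E
     * elog2 (((1 - eta) ^+ 2)%R%:E / (4 * u)%R%:E)
   + ((1 - eta) * (1 + eta) / 4)%R%:E
     * elog2 (((1 - eta) * (1 + eta))%R%:E / (2 * v)%R%:E)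
   + ((1 + eta) ^+ 2 / 8)%R%:E
     * elog2 (((1 + eta) ^+ 2)%R%:E / (4 * (1 - u - v))%R%:E))%E.

Definition feasible (d u v : R) : Prop :=
  [/\ 0 <= u /\ 0 <= v,
      u + v <= 1,
      0 <= 1 - 2 * v,
      0 <= (d - 1) - 2 * d * u + (2 - d) * v &
      0 <= (d - 1) ^+ 2 + 4 * d * u + 2 * (d - 1) * v].

End Formula.

(* Main.v *)
Require Import Defs.
From mathcomp Require Import all_boot all_order all_algebra all_fingroup.
From mathcomp Require Import spectral sesquilinear cyclic separable cyclotomic.
From mathcomp Require Import all_classical all_reals ereal exp.
From mathcomp.real_closed Require Import complex mxtens.
From mathcomp Require Import ring lra.

(** Write P_+ and P_- for the projectors onto the symmetric and antisymmetric
    subspaces.  The state W (x) W is a mixture of the four projectors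
    P_s (x) P_t, hence commutes with its competitor at the optimum, the mixture
    sigma with weights x0 on P_- (x) P_-, x1/2 on each mixed term and
    1 - x0 - x1 on P_+ (x) P_+.

    Lower bound.  Applying ln s <= ln c + s/c - 1 to the eigenvalues s of any
    state tau reduces S(W (x) W || tau) >= S(W (x) W || sigma) to the linear
    inequality sum_k (p_k / x_k) Tr(Q_k tau) <= 1.  By the first-order
    optimality of (x0, x1), a quadratic equation for x1, its slack is a
    nonnegative multiple of (d - 1) - 2 d u + (2 - d) v, which is
    nonnegative on separable states: with F1, F2 the two flips this says
    2 Tr(F1 F2 tau) <= d (Tr(F1 tau) + Tr(F2 tau)), and on product vectors
    it is the Cauchy-Schwarz inequality.

    Attainment.  The point (x0, x1) lies on the segment between
    ((d - 1) / 2d, 0) and (1/4, 1/2).  The second point is W_0 (x) W_0 with W_0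
    separable.  The first one is proportional to d (1 + F1 F2) - F1 - F2, the
    average of |U>><<U| (x) |U>><<U| over a unitary 2-design; a weighted finite
    2-design valid in every dimension is obtained from the identity and the
    Fourier matrix by permuting columns and multiplying rows and columns by
    fourth roots of unity. *)

Set Implicit Arguments.
Unset Strict Implicit.
Unset Printing Implicit Defensive.

Import Order.TTheory GRing.Theory Num.Theory.
Local Open Scope complex_scope.
Local Open Scope sesquilinear_scope.
Local Open Scope ring_scope.

(** * Spectral calculus and relative entropy *)

Section Tangent.
Context {R : realType}.
Implicit Types x y : R.

Lemma ln2_gt0 : 0 < ln 2 :> R.
Proof. by apply: ln_gt0; rewrite ltr1n. Qed.

Lemma log2_le_tangent x y : 0 < x -> 0 < y ->
  log2 y <= log2 x + (y / x - 1) / ln 2.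
Proof.
move=> x0 y0; rewrite /log2 -mulrDl ler_pM2r ?invr_gt0 ?ln2_gt0 //.
have : ln (y / x) <= y / x - 1.
  have {1}-> : y / x = 1 + (y / x - 1) by rewrite addrC subrK.
  by apply: le_ln1Dx; rewrite ltrBDr addrC subrr divr_gt0.
by rewrite ln_div ?posrE //; lra.
Qed.

End Tangent.

Section Hermitian.
Context {C : numClosedFieldType}.

Lemma mxtrace_sum n (I : finType) (F : I -> 'M[C]_n) :
  \tr (\sum_i F i) = \sum_i \tr (F i).
Proof. exact: raddf_sum. Qed.

Lemma mxtraceB n (A B : 'M[C]_n) : \tr (A - B) = \tr A - \tr B.
Proof. exact: raddfB. Qed.

Lemma hermsymmxP n (A : 'M[C]_n) : reflect (A = A^t*) (A \is hermsymmx).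
Proof. by apply: (iffP (is_hermitianmxP _ _ _)); rewrite expr0 scale1r. Qed.

Lemma trmxC_mul m n p (A : 'M[C]_(m, n)) (B : 'M[C]_(n, p)) :
  (A *m B)^t* = B^t* *m A^t*.
Proof. by rewrite trmx_mul map_mxM. Qed.

Lemma trmxCD m n (A B : 'M[C]_(m, n)) : (A + B)^t* = A^t* + B^t*.
Proof. by apply/matrixP => i j; rewrite !mxE rmorphD. Qed.

Lemma trmxCB m n (A B : 'M[C]_(m, n)) : (A - B)^t* = A^t* - B^t*.
Proof. by apply/matrixP => i j; rewrite !mxE rmorphB. Qed.

Lemma unitary_tmulmx n (P : 'M[C]_n) : P \is unitarymx -> P^t* *m P = 1%:M.
Proof. by move=> u; rewrite -invmx_unitary // mulVmx // unitarymx_unit. Qed.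

Lemma hermitian_spectralP n (A : 'M[C]_n) : A \is hermsymmx ->
  A = (spectralmx A)^t* *m diag_mx (spectral_diag A) *m spectralmx A.
Proof.
move=> /hermitian_normalmx /orthomx_spectralP {1}->.
by rewrite invmx_unitary ?spectral_unitarymx.
Qed.

End Hermitian.

Section FunctionalCalculus.
Context {R : realType}.
Local Notation C := R[i].

Lemma funmxE (f : R -> R) n (A : 'M[C]_n) :
  funmx f A = (spectralmx A)^t*
    *m diag_mx (map_mx (fun z : C => (f (complex.Re z))%:C) (spectral_diag A))
    *m spectralmx A.
Proof. by rewrite /funmx invmx_unitary ?spectral_unitarymx. Qed.

Lemma spectral_diagE n (A : 'M[C]_n) j : A \is hermsymmx ->
  spectral_diag A 0 j = (complex.Re (spectral_diag A 0 j))%:C.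
Proof.
move=> hA; rewrite RRe_real //.
by have /mxOverP := hermitian_spectral_diag_real hA; apply.
Qed.

Lemma funmx_id n (A : 'M[C]_n) : A \is hermsymmx -> funmx id A = A.
Proof.
move=> hA; rewrite funmxE [RHS](hermitian_spectralP hA).
rewrite (_ : map_mx _ _ = spectral_diag A) //.
by apply/rowP => j; rewrite mxE -spectral_diagE.
Qed.

Lemma funmx_cst1 n (A : 'M[C]_n) : funmx (fun=> 1) A = 1%:M.
Proof.
rewrite funmxE.
rewrite (_ : map_mx _ _ = const_mx 1 :> 'rV_n); last by apply/rowP => j; rewrite !mxE.
by rewrite diag_const_mx mulmx1 unitary_tmulmx // spectral_unitarymx.
Qed.

Lemma spectral_mulmx n (A : 'M[C]_n) : A \is hermsymmx ->
  spectralmx A *m A = diag_mx (spectral_diag A) *m spectralmx A.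
Proof.
move=> hA; rewrite {2}(hermitian_spectralP hA) !mulmxA.
by rewrite (unitarymxP (spectral_unitarymx A)) mul1mx.
Qed.

(** In the spectral basis, [A *m Q = a *: Q] says that row [i] of [P *m Q] vanishes unless the
    [i]-th eigenvalue is [a]. Hence applying [f] to all eigenvalues has the same effect on [Q] as
    applying it to [a] alone. *)
Lemma funmx_eigen f n p (A : 'M[C]_n) (Q : 'M[C]_(n, p)) (a : R) :
  A \is hermsymmx -> A *m Q = a%:C *: Q -> funmx f A *m Q = (f a)%:C *: Q.
Proof.
move=> hA AQ; set P := spectralmx A.
have PAQ : diag_mx (spectral_diag A) *m (P *m Q) = a%:C *: (P *m Q).
  by rewrite mulmxA -spectral_mulmx // -mulmxA AQ scalemxAr.
rewrite funmxE -!mulmxA -/P.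
have -> : diag_mx (map_mx (fun z : C => (f (complex.Re z))%:C) (spectral_diag A))
    *m (P *m Q) = (f a)%:C *: (P *m Q).
  apply/matrixP => i j; have /matrixP/(_ i j) := PAQ.
  rewrite !mul_diag_mx !mxE; move: (\sum__ _) => z.
  move/eqP; rewrite -subr_eq0 -mulrBl mulf_eq0 => /orP[|/eqP ->]; last first.
    by rewrite !mulr0.
  by rewrite subr_eq0 => /eqP ->.
by rewrite -scalemxAr mulmxA unitary_tmulmx ?spectral_unitarymx // mul1mx.
Qed.

(** The rows of [spectralmx A] are the eigenbras, so this is the expansion of the trace in an
    eigenbasis of [A]. It turns operator inequalities into scalar ones, eigenvalue by eigenvalue. *)
Lemma trace_mul_funmx f n (A Q : 'M[C]_n) :
  \tr (Q *m funmx f A) = \sum_j (f (complex.Re (spectral_diag A 0 j)))%:C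
     * (row j (spectralmx A) *m Q *m (row j (spectralmx A))^t*) 0 0.
Proof.
rewrite funmxE mulmxA mxtrace_mulC mulmxA mulmxA mxtrace_mulC /mxtrace.
apply: eq_bigr => j _; rewrite mul_diag_mx mxE [in LHS]mxE; congr (_ * _).
by rewrite -row_mul [LHS]mxE [RHS]mxE; apply: eq_bigr => k _; rewrite !mxE.
Qed.

Lemma trace_funmx_eigen f n (A Q : 'M[C]_n) (a : R) :
  A \is hermsymmx -> A *m Q = a%:C *: Q ->
  \tr (Q *m funmx f A) = (f a)%:C * \tr Q.
Proof. by move=> hA AQ; rewrite mxtrace_mulC (funmx_eigen f hA AQ) mxtraceZ. Qed.

End FunctionalCalculus.

Section RelativeEntropy.
Context {R : realType} {n : nat} {K : finType}.
Local Notation C := R[i].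
Variable (Q : K -> 'M[C]_n).
Hypothesis Q_psd : forall k, psdmx (Q k).

Definition mixmx (a : K -> R) : 'M[C]_n := \sum_k (a k)%:C *: Q k.
Local Notation q k := (complex.Re (\tr (Q k))).

Lemma Re_bigsum (I : finType) (F : I -> C) :
  complex.Re (\sum_i F i) = \sum_i complex.Re (F i).
Proof. by apply: (big_morph (@complex.Re R)) => // -[a b] [c e]. Qed.

Lemma Re_mul_real (a : R) (z : C) : complex.Re (a%:C * z) = a * complex.Re z.
Proof. by case: z => x y /=; rewrite mul0r subr0. Qed.

Lemma mixmx_herm a : mixmx a \is hermsymmx.
Proof.
apply/hermsymmxP; rewrite /mixmx raddf_sum /= raddf_sum /=; apply: eq_bigr => k _.
rewrite linearZ /= map_mxZ /=.
have [/hermsymmxP hQ _] := Q_psd k; congr (_ *: _) => //.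
by rewrite conj_Creal // complex_real.
Qed.

(** For each [k], the tangent to [log2] at [c k] bounds [log2] of every positive eigenvalue of
    [sigma]. Averaging these bounds with the nonnegative weights [r k j], the overlaps of [Q k] with
    the eigenvectors, gives the claim. *)
Lemma trace_mixmx_log2mx_le (a c : K -> R) (sigma : 'M[C]_n) :
  psdmx sigma -> (forall k, 0 <= a k) -> (forall k, 0 < a k -> 0 < c k) ->
  (mixmx a <= sigma)%MS ->
  complex.Re (\tr (mixmx a *m log2mx sigma)) <=
  \sum_k a k * (q k * log2 (c k)
     + (complex.Re (\tr (Q k *m sigma)) / c k - q k) / ln 2).
Proof.
move=> [sH s0] a0 ac /submxP[X rhoE].
pose v j := row j (spectralmx sigma).
pose s j := complex.Re (spectral_diag sigma 0 j).
pose r k j := complex.Re ((v j *m Q k *m (v j)^t*) 0 0).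
have rE k j : (v j *m Q k *m (v j)^t*) 0 0 = (r k j)%:C.
  by rewrite /r RRe_real // ger0_real // (Q_psd k).2.
have r0 k j : 0 <= r k j by rewrite -ler0c -rE (Q_psd k).2.
have trE f k : complex.Re (\tr (Q k *m funmx f sigma)) = \sum_j f (s j) * r k j.
  rewrite trace_mul_funmx Re_bigsum; apply: eq_bigr => j _.
  by rewrite -/(v j) rE Re_mul_real.
(* Both the trace of [Q k] and its pairing with [sigma] are read off [trE], with [f] constant 1 here
   and the identity below. *)
have qE k : q k = \sum_j r k j.
  rewrite -[Q k in LHS]mulmx1 -(funmx_cst1 sigma) trE.
  by apply: eq_bigr => j _; rewrite mul1r.
have qsE k : complex.Re (\tr (Q k *m sigma)) = \sum_j s j * r k j.
  by rewrite -{1}(funmx_id sH) trE.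
have vs j : v j *m sigma = (s j)%:C *: v j.
  rewrite /v -row_mul spectral_mulmx // mul_diag_mx; apply/rowP => k.
  by rewrite !mxE /s -spectral_diagE.
have sj0 j : 0 <= s j.
  have := s0 (v j); rewrite vs -scalemxAl.
  have /row_unitarymxP /(_ j j) := spectral_unitarymx sigma.
  by rewrite dotmxE eqxx => e; rewrite [X in _ <= X]mxE e mulr1 ler0c.
(* An eigenvector in the kernel of [sigma] is also killed by the mixture, by inclusion of the row
   spaces. Its expectation is a sum of nonnegative terms, which therefore all vanish. *)
have supp k j : s j = 0 -> a k * r k j = 0.
  move=> sj; have vs0 : sigma *m (v j)^t* = 0.
    by rewrite (hermsymmxP _ sH) -trmxC_mul vs sj scale0r trmx0 map_mx0.
  have : (v j *m mixmx a *m (v j)^t*) 0 0 = 0.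
    by rewrite rhoE -mulmxA -mulmxA vs0 !mulmx0 mxE.
  rewrite /mixmx mulmx_sumr mulmx_suml summxE => e.
  have : \sum_k a k * r k j = 0.
    apply: (@complexI R); rewrite rmorph_sum /= -[RHS]e; apply: eq_bigr => l _.
    by rewrite -scalemxAr -scalemxAl mxE rE rmorphM.
  move/eqP; rewrite psumr_eq0 => [/allP /(_ k)|l _]; last by rewrite mulr_ge0.
  by rewrite mem_index_enum => /(_ isT) /eqP.
rewrite /mixmx mulmx_suml mxtrace_sum Re_bigsum; apply: ler_sum => k _.
rewrite -scalemxAl mxtraceZ Re_mul_real /log2mx trE qsE qE.
have [->|ak] := eqVneq (a k) 0; first by rewrite !mul0r.
have {}ak : 0 < a k by rewrite lt_neqAle eq_sym ak a0.
rewrite ler_pM2l //.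
have -> : (\sum_j r k j) * log2 (c k) +
   ((\sum_j s j * r k j) / c k - \sum_j r k j) / ln 2 =
   \sum_j (log2 (c k) + (s j / c k - 1) / ln 2) * r k j.
  rewrite !mulr_suml -sumrB mulr_suml -big_split /=; apply: eq_bigr => j _.
  by ring.
apply: ler_sum => j _.
(* The tangent bound requires a positive eigenvalue and may fail for the default [log2 0 = 0]. At a
   zero eigenvalue the overlap itself vanishes by [supp]. *)
have [sj|sj] := eqVneq (s j) 0.
  have /eqP := supp k j sj; rewrite mulf_eq0 gt_eqF //= => /eqP ->.
  by rewrite !mulr0.
apply: ler_wpM2r => //; apply: log2_le_tangent; first exact: ac.
by rewrite lt_neqAle eq_sym sj sj0.
Qed.

Hypothesis Q_orth : forall k l, Q k *m Q l = if k == l then Q k else 0.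

Lemma mixmx_eigen a k : mixmx a *m Q k = (a k)%:C *: Q k.
Proof.
rewrite /mixmx mulmx_suml (bigD1 k) //= -scalemxAl Q_orth eqxx.
rewrite big1 ?addr0 // => l lk; rewrite -scalemxAl Q_orth (negPf lk).
by rewrite scaler0.
Qed.

(** By orthogonality each [Q k] consists of eigencolumns of the mixture with eigenvalue [c k], so
    the calculus acts on it as the scalar [f (c k)]. *)
Lemma trace_mixmx_funmx f a c :
  complex.Re (\tr (mixmx a *m funmx f (mixmx c))) = \sum_k a k * (f (c k) * q k).
Proof.
rewrite {1}/mixmx mulmx_suml mxtrace_sum Re_bigsum; apply: eq_bigr => k _.
rewrite -scalemxAl mxtraceZ Re_mul_real.
by rewrite (trace_funmx_eigen f (mixmx_herm c) (mixmx_eigen c k)) Re_mul_real.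
Qed.

Lemma mixmx_mul a c : mixmx a *m mixmx c = mixmx (fun k => a k * c k).
Proof.
rewrite {2}/mixmx mulmx_sumr; apply: eq_bigr => k _.
by rewrite -scalemxAr mixmx_eigen scalerA -rmorphM mulrC.
Qed.

Lemma Re_add (x y : C) : complex.Re (x + y) = complex.Re x + complex.Re y.
Proof. by case: x y => [a b] [c e]. Qed.

Lemma Re_sub (x y : C) : complex.Re (x - y) = complex.Re x - complex.Re y.
Proof. by case: x y => [a b] [c e]. Qed.

Lemma relative_entropy_mixmx a c : (forall k, c k = 0 -> a k = 0) ->
  relative_entropy (mixmx a) (mixmx c)
  = (\sum_k a k * q k * (log2 (a k) - log2 (c k)))%:E.
Proof.
move=> ca; rewrite /relative_entropy.
have -> : (mixmx a <= mixmx c)%MS.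
  (* The quotient is taken inside the commutative algebra of mixtures. Where [c k = 0] both sides
     vanish, since then [a k = 0]. *)
  apply/submxP; exists (mixmx (fun k => a k / c k)).
  rewrite mixmx_mul; apply: eq_bigr => k _; congr (_%:C *: _).
  by have [/[dup] /ca -> ->|ck] := eqVneq (c k) 0; rewrite ?mul0r // divfK.
rewrite mxtraceB Re_sub /log2mx [X in X - _](trace_mixmx_funmx log2 a a).
rewrite [X in _ - X](trace_mixmx_funmx log2 a c) -sumrB; congr (_%:E).
by apply: eq_bigr => k _; ring.
Qed.

(** Summing the tangent bounds leaves a slack of [1 / ln 2] times one minus the weighted sum of the
    traces against [sigma]. The last hypothesis makes it nonnegative. *)
Lemma relative_entropy_mixmx_ge a c sigma :
  psdmx sigma -> (forall k, 0 <= a k) -> (forall k, 0 < a k -> 0 < c k) ->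
  \sum_k a k * q k = 1 ->
  \sum_k a k / c k * complex.Re (\tr (Q k *m sigma)) <= 1 ->
  ((\sum_k a k * q k * (log2 (a k) - log2 (c k)))%:E
    <= relative_entropy (mixmx a) sigma)%E.
Proof.
move=> sP a0 ac a1 w1; rewrite /relative_entropy; case: ifP => [sup|_]; last exact: leey.
rewrite lee_fin mxtraceB Re_sub /log2mx [X in X - _](trace_mixmx_funmx log2 a a).
have := trace_mixmx_log2mx_le sP a0 ac sup; rewrite /log2mx => h.
apply: le_trans (lerB (lexx _) h); rewrite -subr_ge0 -sumrB -sumrB.
under eq_bigr => k _.
  rewrite (_ : _ - _ =
    (a k * q k - a k / c k * complex.Re (\tr (Q k *m sigma))) / ln 2); last first.
    move: (complex.Re (\tr (Q k *m sigma))) (q k) (log2 (a k)) => x y z.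
    by ring.
  over.
by rewrite -mulr_suml sumrB a1 divr_ge0 ?subr_ge0 // ltW // ln2_gt0.
Qed.

End RelativeEntropy.

(** * The optimal point *)

Section OptimalPoint.
Context {R : realType}.
Variables (d eta : R).
Hypotheses (d_gt2 : 2 < d) (eta_ge : -1 <= eta) (eta_le : eta <= - (2 / d)).

Local Notation x0 := (werner_x0 d eta).
Local Notation x1 := (werner_x1 d eta).
Local Notation s := (Num.sqrt (werner_theta d eta)).
(** [A] and [B] are the coefficients of the quadratic [A x^2 - B x + p1 (d^2 - 1)] whose smaller
    root is [x1]. The numbers [p0], [p1], [p2] are the probabilities that W (x) W gives to two
    antisymmetric, mixed and two symmetric copies. *)
Local Notation A := (d ^+ 2 - 4).
Local Notation B := (((d ^+ 2 - 2) * (3 - eta ^+ 2) + 2 * d * eta) / 2).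
Local Notation p0 := ((1 - eta) ^+ 2 / 4).
Local Notation p1 := ((1 - eta) * (1 + eta) / 2).
Local Notation p2 := ((1 + eta) ^+ 2 / 4).

Lemma d_mul_eta_le : d * eta <= - 2.
Proof.
have d2 := d_gt2.
have d0 : 0 < d by lra.
have := eta_le; rewrite -(ler_pM2l d0) mulrN mulrCA divff ?mulr1 //.
by rewrite gt_eqF.
Qed.

Lemma eta_lt0 : eta < 0.
Proof.
have d2 := d_gt2. have ? := d_mul_eta_le.
have d0 : 0 < d by lra.
by rewrite -(pmulr_rlt0 _ d0); have := d_mul_eta_le; lra.
Qed.

Lemma werner_x1E : x1 = (2 * B - s) / (4 * A).
Proof.
by rewrite /werner_x1 -mulNr; congr (_ / _); field. Qed.

Lemma sqr_d_sub4_gt0 : 0 < A.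
Proof.
have d2 := d_gt2.
by nra. Qed.

(** The square roots in [x0] and [x1] cancel. The optimum thus lies on the boundary of the fourth
    feasibility constraint. *)
Lemma werner_line : (d - 1) - 2 * d * x0 + (2 - d) * x1 = 0.
Proof.
have d2 := d_gt2. have ? := sqr_d_sub4_gt0.
rewrite /werner_x0 /werner_x1; field.
by rewrite !gt_eqF //=; lra.
Qed.

(** This identifies [werner_theta] as four times the discriminant of the quadratic for [x1]. *)
Lemma werner_thetaE : werner_theta d eta = 4 * (B ^+ 2 - 4 * A * (p1 * (d ^+ 2 - 1))).
Proof.
by rewrite /werner_theta; field. Qed.

(** The difference is [4 A] times [d eta (d eta + 2)], a product of two nonpositive factors as
    [d eta <= -2]. This bound is what keeps [x1] at most 1/2. *)
Lemma werner_theta_ge : 4 * (B - A) ^+ 2 <= werner_theta d eta.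
Proof.
have ? := sqr_d_sub4_gt0. have ? := d_mul_eta_le.
rewrite werner_thetaE -subr_ge0.
have -> : 4 * (B ^+ 2 - 4 * A * (p1 * (d ^+ 2 - 1))) - 4 * (B - A) ^+ 2
  = 4 * A * ((d * eta) * (d * eta + 2)) by field.
by apply: mulr_ge0; [lra|nra].
Qed.

Lemma werner_theta_ge0 : 0 <= werner_theta d eta.
Proof.
by apply: le_trans werner_theta_ge; rewrite mulr_ge0 // sqr_ge0. Qed.

Lemma sqr_sqrt_werner_theta : s ^+ 2 = werner_theta d eta.
Proof.
exact: sqr_sqrtr werner_theta_ge0. Qed.

Lemma weight1_ge0 : 0 <= p1.
Proof.
have em1 := eta_ge. have ? := eta_lt0.
by apply: divr_ge0; [apply: mulr_ge0; lra|lra]. Qed.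

Lemma werner_b_gt0 : 0 < B.
Proof.
have d2 := d_gt2. have em1 := eta_ge. have ? := eta_lt0. have ? := d_mul_eta_le.
have : 0 <= (1 - eta) * (1 + eta) by apply: mulr_ge0; lra.
have : - d <= d * eta by nra.
nra.
Qed.

(** The product of the roots is nonnegative and [B] is positive, so the square root does not exceed
    [2 B]. *)
Lemma werner_x1_ge0 : 0 <= x1.
Proof.
have d2 := d_gt2. have ? := sqr_d_sub4_gt0. have ? := weight1_ge0. have ? := werner_b_gt0.
rewrite werner_x1E; apply: divr_ge0; last by lra.
rewrite subr_ge0 -(ler_pXn2r (n := 2)) ?nnegrE ?sqrtr_ge0 //; last by lra.
rewrite sqr_sqrt_werner_theta werner_thetaE.
have : 0 <= A * (p1 * (d ^+ 2 - 1)).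
  by apply: mulr_ge0; [lra|apply: mulr_ge0 => //; nra].
by lra.
Qed.

Lemma werner_x1_le : x1 <= 2^-1.
Proof.
have ? := sqr_d_sub4_gt0.
rewrite werner_x1E ler_pdivrMr; last by lra.
suff : 2 * (B - A) <= s by lra.
have [h|h] := leP (B - A) 0; first by apply: (@le_trans _ _ 0); [lra|exact: sqrtr_ge0].
rewrite -(ler_pXn2r (n := 2)) ?nnegrE ?sqrtr_ge0 //; last by lra.
by rewrite sqr_sqrt_werner_theta exprMn; apply: le_trans werner_theta_ge; rewrite -natrX.
Qed.

(** This is stationarity of the objective along the line of [werner_line], cleared of denominators;
    the leading coefficient is [A] because the three probabilities sum to 1. *)
Lemma werner_quadratic : A * x1 ^+ 2 - B * x1 + p1 * (d ^+ 2 - 1) = 0.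
Proof.
have ? := sqr_d_sub4_gt0.
have h : 4 * A * x1 = 2 * B - s.
  by rewrite werner_x1E mulrC divfK // gt_eqF //; lra.
have : (4 * A * x1 - 2 * B) ^+ 2 = 4 * (B ^+ 2 - 4 * A * (p1 * (d ^+ 2 - 1))).
  by rewrite h -werner_thetaE -[RHS]sqr_sqrt_werner_theta; ring.
move=> h2.
have : 16 * A * (A * x1 ^+ 2 - B * x1 + p1 * (d ^+ 2 - 1)) = 0.
  by have := h2; lra.
move/eqP; rewrite mulf_eq0 => /orP[|/eqP //].
by rewrite gt_eqF //; lra.
Qed.

Lemma weight1_gt0 : -1 < eta -> 0 < p1.
Proof.
have ? := eta_lt0.
by move=> h; apply: divr_gt0; [apply: mulr_gt0; lra|lra]. Qed.

Lemma werner_x1_gt0 : -1 < eta -> 0 < x1.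
Proof.
have d2 := d_gt2.
move=> h; rewrite lt_neqAle werner_x1_ge0 andbT eq_sym.
apply/eqP => x10; have := werner_quadratic; rewrite x10.
have := weight1_gt0 h => h1.
have : 0 < p1 * (d ^+ 2 - 1) by apply: mulr_gt0 => //; nra.
by lra.
Qed.

Lemma werner_x0E : 2 * d * x0 = d - 1 - (d - 2) * x1.
Proof.
by have := werner_line; lra. Qed.

Lemma werner_x2E : 2 * d * (1 - x0 - x1) = d + 1 - (d + 2) * x1.
Proof.
by have := werner_line; lra. Qed.

Lemma werner_x0_gt0 : 0 < x0.
Proof.
have d2 := d_gt2.
have := werner_x0E; have := werner_x1_le; nra. Qed.

Lemma werner_x2_gt0 : 0 < 1 - x0 - x1.
Proof.
have d2 := d_gt2.
have := werner_x2E; have := werner_x1_le; nra. Qed.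

(* The left-hand side equals [1 - mu * ((d - 1) - 2 d u + (2 - d) v)] for some [mu >= 0],
   except at [eta = -1], where [p1 / x1 = 0 / 0 = 0]. *)
Lemma werner_tangent_le1 (u v : R) : 0 <= u -> 0 <= v ->
  0 <= (d - 1) - 2 * d * u + (2 - d) * v ->
  p0 / x0 * u + p1 / x1 * v + p2 / (1 - x0 - x1) * (1 - u - v) <= 1.
Proof.
have d2 := d_gt2. have em1 := eta_ge. have ? := eta_lt0. have ? := sqr_d_sub4_gt0.
move=> u0 v0 L0.
have x00 := werner_x0_gt0; have x20 := werner_x2_gt0.
(* At [eta = -1] the state is supported on two antisymmetric copies, and only the term in [u]
   survives. *)
have [e1|e1] := eqVneq eta (-1).
  have p10 : p1 = 0 by rewrite e1; field.
  have p20 : p2 = 0 by rewrite e1; field.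
  have p01 : p0 = 1 by rewrite e1; field.
  (* The quadratic becomes [x1 (A x1 - B) = 0], and [A x1 <= A / 2 < B] excludes the second
     factor. *)
  have x10 : x1 = 0.
    have := werner_quadratic; rewrite p10 => h.
    have : x1 * (A * x1 - B) = 0 by lra.
    move/eqP; rewrite mulf_eq0 => /orP[/eqP //|/eqP h3].
    have h4 : A * x1 <= A * 2^-1 by rewrite ler_pM2l // werner_x1_le.
    have : A * 2^-1 < B by rewrite e1; nra.
    lra.
  have h := werner_x0E; rewrite x10 in h.
  rewrite p10 p20 !mul0r !addr0 p01 mul1r mulrC ler_pdivrMr // mul1r.
  have : 2 * d * u <= 2 * d * x0 by nra.
  by rewrite ler_pM2l //; lra.
have ge1 : -1 < eta by rewrite lt_neqAle eq_sym e1.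
have x10 := werner_x1_gt0 ge1.
(* The Lagrange multiplier, found by comparing the coefficients of [u]. It is nonnegative because
   [p2 <= p0], as [eta < 0], and [x0 <= 1 - x0 - x1], as [x1 <= 1/2]. *)
pose mu := (p0 / x0 - p2 / (1 - x0 - x1)) / (2 * d).
have mu0 : 0 <= mu.
  apply: divr_ge0; last by lra.
  rewrite subr_ge0 ler_pdivrMr // [leRHS]mulrAC ler_pdivlMr //.
  have h1 : p2 <= p0 by rewrite ler_pM2r //; nra.
  have h2 : x0 <= 1 - x0 - x1.
    have := werner_x0E; have := werner_x2E; have := werner_x1_le; nra.
  by apply: ler_pM => //; [apply: divr_ge0; rewrite ?sqr_ge0|apply: ltW].
suff -> : p0 / x0 * u + p1 / x1 * v + p2 / (1 - x0 - x1) * (1 - u - v)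
   = 1 - mu * ((d - 1) - 2 * d * u + (2 - d) * v).
  by rewrite gerDl oppr_le0 mulr_ge0.
have X0 : x0 = (d - 1 - (d - 2) * x1) / (2 * d).
  by rewrite -werner_x0E mulrC mulKf // gt_eqF //; lra.
have q := werner_quadratic.
have n0 : d - 1 - (d - 2) * x1 != 0 by rewrite -werner_x0E mulf_neq0 ?gt_eqF //; lra.
have n2 : d + 1 - (d + 2) * x1 != 0 by rewrite -werner_x2E mulf_neq0 ?gt_eqF //; lra.
have n1 : x1 != 0 by rewrite gt_eqF.
have nd : d != 0 by rewrite gt_eqF //; lra.
have X2 : 1 - x0 - x1 = (d + 1 - (d + 2) * x1) / (2 * d).
  by rewrite -werner_x2E mulrC mulKf // gt_eqF //; lra.
rewrite /mu X2 X0; move: (x1) q n0 n1 n2 => x q n0 n1 n2.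
apply/eqP; rewrite -subr_eq0; apply/eqP.
(* With [mu] chosen, the two sides differ by an affine function of [v] vanishing at [v = x1]; its
   coefficient is a multiple of the quadratic. *)
transitivity ((A * x ^+ 2 - B * x + p1 * (d ^+ 2 - 1)) *
   (v / x - 1) / ((d - 1 - (d - 2) * x) * (d + 1 - (d + 2) * x))); last first.
  by rewrite q !mul0r.
field.
by rewrite n0 n1 n2 nd.
Qed.

Lemma werner_feasible : feasible d x0 x1.
Proof.
have d2 := d_gt2.
have h0 := werner_x0_gt0; have h1 := werner_x1_ge0; have h2 := werner_x2_gt0.
have h3 := werner_x1_le; have h4 := werner_line.
split; [by split; lra|lra|lra|lra|].
by nra.
Qed.

End OptimalPoint.

(** * The objective and its minimum, with extended-real boundary values *)

Section Objective.
Context {R : realType}.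
Implicit Types p x y k u v eta : R.

Lemma log2_ge_tangent p x y : 0 < p -> 0 < x -> 0 < y ->
  log2 (p / x) + (1 - y / x) / ln 2 <= log2 (p / y).
Proof.
move=> p0 x0 y0; have := log2_le_tangent x0 y0.
rewrite /log2 !ln_div ?posrE // !mulrBl mul1r.
by lra.
Qed.

Lemma elog2_ratio k p y : 0 < k -> 0 <= p -> 0 < y ->
  ((p / 2)%:E * elog2 ((k * p)%:E / (k * y)%:E) = (p / 2 * log2 (p / y))%:E)%E.
Proof.
move=> k0 p0 y0; have [->|pn0] := eqVneq p 0; first by rewrite !mul0r mul0e.
have pp : 0 < p by rewrite lt_neqAle eq_sym pn0.
rewrite inver gt_eqF ?mulr_gt0 // -EFinM -mulf_div divff ?gt_eqF // mul1r.
rewrite /elog2 lne_EFin ?divr_gt0 // inver gt_eqF ?ln2_gt0 //.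
Qed.

(** The tangent at [x] to the convex function [y |-> p / 2 * log2 (p / y)], extended to the
    boundary: for [p = 0] both sides are 0, and for [y = 0 < p] the right side is [+oo]. *)
Lemma elog2_ratio_ge k p x y : 0 < k -> 0 <= p -> (0 < p -> 0 < x) -> 0 <= y ->
  ((p / 2 * log2 (p / x) + (p - p / x * y) / (2 * ln 2))%:E
    <= (p / 2)%:E * elog2 ((k * p)%:E / (k * y)%:E))%E.
Proof.
move=> k0 p0 px y0; have [->|pn0] := eqVneq p 0.
  by rewrite !mul0r subr0 mul0r addr0 mul0e.
have pp : 0 < p by rewrite lt_neqAle eq_sym pn0.
have x0 := px pp.
have [->|yn0] := eqVneq y 0.
  rewrite !mulr0 subr0 inver eqxx mulry gtr0_sg ?mulr_gt0 // mul1e /elog2 /= inver.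
  rewrite gt_eqF ?ln2_gt0 // gt0_mulye ?lte_fin ?invr_gt0 ?ln2_gt0 //.
  by rewrite gt0_muley ?lte_fin ?divr_gt0 // leey.
have yy : 0 < y by rewrite lt_neqAle eq_sym yn0.
rewrite elog2_ratio // lee_fin.
have -> : (p - p / x * y) / (2 * ln 2) = p / 2 * ((1 - y / x) / ln 2).
  by field; rewrite !gt_eqF //= ln2_gt0.
by rewrite -mulrDr ler_pM2l ?divr_gt0 // log2_ge_tangent.
Qed.

Lemma objectiveE eta u v : objective eta u v =
  let p0 := (1 - eta) ^+ 2 / 4 in
  let p1 := (1 - eta) * (1 + eta) / 2 in
  let p2 := (1 + eta) ^+ 2 / 4 in
  ((p0 / 2)%:E * elog2 ((4 * p0)%:E / (4 * u)%:E)
   + (p1 / 2)%:E * elog2 ((2 * p1)%:E / (2 * v)%:E)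
   + (p2 / 2)%:E * elog2 ((4 * p2)%:E / (4 * (1 - u - v))%:E))%E.
Proof.
rewrite /objective /=; congr (_%:E * elog2 (_%:E / _) +
  _%:E * elog2 (_%:E / _) + _%:E * elog2 (_%:E / _))%E; by field.
Qed.

End Objective.
Section ObjectiveMin.
Context {R : realType}.
Variables (d eta : R).
Hypotheses (d_gt2 : 2 < d) (eta_ge : -1 <= eta) (eta_le : eta <= - (2 / d)).
Local Notation x0 := (werner_x0 d eta).
Local Notation x1 := (werner_x1 d eta).
Local Notation p0 := ((1 - eta) ^+ 2 / 4).
Local Notation p1 := ((1 - eta) * (1 + eta) / 2).
Local Notation p2 := ((1 + eta) ^+ 2 / 4).

Lemma werner_x1_gt0_weight1 : 0 < p1 -> 0 < x1.
Proof.
move=> p10; apply: werner_x1_gt0 => //.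
rewrite lt_neqAle eta_ge andbT; apply: contraTneq p10 => <-.
by rewrite subrr mulr0 mul0r ltxx.
Qed.

Lemma objective_optE : objective eta x0 x1 =
  ((p0 * log2 (p0 / x0) + p1 * log2 (p1 / x1)
    + p2 * log2 (p2 / (1 - x0 - x1))) / 2)%:E.
Proof.
have x00 : 0 < x0 by exact: werner_x0_gt0.
have x20 : 0 < 1 - x0 - x1 by exact: werner_x2_gt0.
have x10 : 0 <= x1 by exact: werner_x1_ge0.
have p10 := weight1_ge0 d_gt2 eta_ge eta_le.
have px := werner_x1_gt0_weight1.
(* Only the middle term can degenerate: [x1] may vanish, but then so does [p1]. *)
have E1 : ((p1 / 2)%:E * elog2 ((2 * p1)%:E / (2 * x1)%:E)
   = (p1 / 2 * log2 (p1 / x1))%:E)%E.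
  have [->|pn0] := eqVneq p1 0; first by rewrite !mul0r mul0e.
  have pp : 0 < p1 by rewrite lt_neqAle eq_sym pn0.
  by rewrite elog2_ratio // px.
rewrite objectiveE /= E1 !elog2_ratio ?divr_ge0 ?sqr_ge0 //.
by rewrite -!EFinD; congr (_%:E); field.
Qed.

(** Three tangent inequalities at the optimum are added. Since the probabilities sum to 1, the
    linear remainder is the slack of [werner_tangent_le1] divided by [2 ln 2]. *)
Lemma objective_opt_le (u v : R) : feasible d u v ->
  (objective eta x0 x1 <= objective eta u v)%E.
Proof.
case=> -[u0 v0] uv _ L0 _.
have x00 : 0 < x0 by exact: werner_x0_gt0.
have x20 : 0 < 1 - x0 - x1 by exact: werner_x2_gt0.
have T := @werner_tangent_le1 R d eta d_gt2 eta_ge eta_le u v u0 v0 L0.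
have l2 := @ln2_gt0 R.
rewrite objective_optE objectiveE /=.
have h0 := @elog2_ratio_ge R 4 p0 x0 u.
have h1 := @elog2_ratio_ge R 2 p1 x1 v.
have h2 := @elog2_ratio_ge R 4 p2 (1 - x0 - x1) (1 - u - v).
have w0 : 0 <= 1 - u - v by lra.
have {}h0 := h0 ltac:(by []) ltac:(by rewrite divr_ge0 ?sqr_ge0) (fun=> x00) u0.
have {}h1 := h1 ltac:(by []) (weight1_ge0 d_gt2 eta_ge eta_le) werner_x1_gt0_weight1 v0.
have {}h2 := h2 ltac:(by []) ltac:(by rewrite divr_ge0 ?sqr_ge0) (fun=> x20) w0.
apply: le_trans (leeD (leeD h0 h1) h2); rewrite -!EFinD lee_fin -subr_ge0.
match goal with |- is_true (0 <= ?X) => have -> : X =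
  (1 - (p0 / x0 * u + p1 / x1 * v + p2 / (1 - x0 - x1) * (1 - u - v))) / (2 * ln 2) end.
  move: (log2 (p0 / x0)) (log2 (p1 / x1)) (log2 (p2 / _)) => a b c.
  have n2 : ln 2 != 0 :> R by rewrite gt_eqF.
  move: (p0 / x0) (p1 / x1) (p2 / (1 - x0 - x1)) => a' b' c'.
  by field.
by rewrite divr_ge0 //; lra.
Qed.

End ObjectiveMin.

(** * The cone of separable operators *)

Section TensorIndex.

Lemma matrix_tensP (T : Type) m n p q (A B : 'M[T]_(m * n, p * q)) :
  (forall i j k l, A (mxtens_index (i, j)) (mxtens_index (k, l))
                 = B (mxtens_index (i, j)) (mxtens_index (k, l))) -> A = B.
Proof.
move=> AB; apply/matrixP => x y.
by case: (mxtens_indexP x) => i j; case: (mxtens_indexP y) => k l.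
Qed.

Lemma sum_mxtens_index (V : nmodType) m n (F : 'I_(m * n) -> V) :
  \sum_k F k = \sum_i \sum_j F (mxtens_index (i, j)).
Proof.
rewrite pair_big; apply: reindex => /=.
exists (@mxtens_unindex m n) => k _; last exact: mxtens_unindexK.
by case: k => i j; rewrite mxtens_indexK.
Qed.

Lemma mxtens_index_eq m n (i k : 'I_m) (j l : 'I_n) :
  (mxtens_index (i, j) == mxtens_index (k, l)) = (i == k) && (j == l).
Proof. by rewrite (can_eq (@mxtens_indexK m n)). Qed.

Lemma mxtrace_tens (R : comPzRingType) m n (A : 'M[R]_m) (B : 'M[R]_n) :
  \tr (A *t B) = \tr A * \tr B.
Proof.
rewrite /mxtrace sum_mxtens_index mulr_suml; apply: eq_bigr => i _.
by rewrite mulr_sumr; apply: eq_bigr => j _; rewrite tensmxE.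
Qed.

Definition ungroup m n (k : 'I_((m * n) * (m * n))) : 'I_((m * m) * (n * n)) :=
  let: (a, b) := mxtens_unindex k in
  let: (a1, b1) := mxtens_unindex a in
  let: (a2, b2) := mxtens_unindex b in
  mxtens_index (mxtens_index (a1, a2), mxtens_index (b1, b2)).

Lemma regroupE m n (a1 a2 : 'I_m) (b1 b2 : 'I_n) :
  regroup (mxtens_index (mxtens_index (a1, a2), mxtens_index (b1, b2)))
  = mxtens_index (mxtens_index (a1, b1), mxtens_index (a2, b2)).
Proof. by rewrite /regroup !mxtens_indexK. Qed.

Lemma ungroupE m n (a1 a2 : 'I_m) (b1 b2 : 'I_n) :
  ungroup (mxtens_index (mxtens_index (a1, b1), mxtens_index (a2, b2)))
  = mxtens_index (mxtens_index (a1, a2), mxtens_index (b1, b2)).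
Proof. by rewrite /ungroup !mxtens_indexK. Qed.

Lemma regroupK m n : cancel (@regroup m n) (@ungroup m n).
Proof.
move=> k; case: (mxtens_indexP k) => a b.
by case: (mxtens_indexP a) => ? ?; case: (mxtens_indexP b) => ? ?; rewrite regroupE ungroupE.
Qed.

Lemma ungroupK m n : cancel (@ungroup m n) (@regroup m n).
Proof.
move=> k; case: (mxtens_indexP k) => a b.
by case: (mxtens_indexP a) => ? ?; case: (mxtens_indexP b) => ? ?; rewrite ungroupE regroupE.
Qed.

End TensorIndex.

Section Regroup.
Context {C : numClosedFieldType}.

Definition regroupmx m n (X : 'M[C]_((m * n) * (m * n))) : 'M[C]_((m * m) * (n * n)) :=
  mxsub (@regroup m n) (@regroup m n) X.

Lemma regroupmxD m n (X Y : 'M[C]_((m * n) * (m * n))) :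
  regroupmx (X + Y) = regroupmx X + regroupmx Y.
Proof. by apply/matrixP => i j; rewrite !mxE. Qed.

Lemma regroupmxZ m n a (X : 'M[C]_((m * n) * (m * n))) :
  regroupmx (a *: X) = a *: regroupmx X.
Proof. by apply/matrixP => i j; rewrite !mxE. Qed.

Lemma regroupmx1 m n : regroupmx (1%:M : 'M[C]_((m * n) * (m * n))) = 1%:M.
Proof.
by apply/matrixP => i j; rewrite !mxE (inj_eq (can_inj (@regroupK m n))).
Qed.

Lemma regroupmx0 m n : regroupmx (0 : 'M[C]_((m * n) * (m * n))) = 0.
Proof. by apply/matrixP => i j; rewrite !mxE. Qed.

Lemma regroupmx_mul m n (X Y : 'M[C]_((m * n) * (m * n))) :
  regroupmx X *m regroupmx Y = regroupmx (X *m Y).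
Proof.
apply/matrixP => i j; rewrite !mxE [RHS](reindex (@regroup m n)) /=.
  by apply: eq_bigr => k _; rewrite !mxE.
by apply: onW_bij; exists (@ungroup m n); [exact: regroupK|exact: ungroupK].
Qed.

Lemma mxtrace_regroup m n (X : 'M[C]_((m * n) * (m * n))) :
  \tr (regroupmx X) = \tr X.
Proof.
rewrite /mxtrace [RHS](reindex (@regroup m n)) /=.
  by apply: eq_bigr => k _; rewrite !mxE.
by apply: onW_bij; exists (@ungroup m n); [exact: regroupK|exact: ungroupK].
Qed.

Lemma trmxC_regroup m n (X : 'M[C]_((m * n) * (m * n))) :
  (regroupmx X)^t* = regroupmx (X^t*).
Proof. by apply/matrixP => i j; rewrite !mxE. Qed.

Lemma trmxC_tens m n p q (A : 'M[C]_(m, n)) (B : 'M[C]_(p, q)) :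
  (A *t B)^t* = A^t* *t B^t*.
Proof. by rewrite trmx_tens map_mxT. Qed.

Lemma tensmxDl m n p q (A A' : 'M[C]_(m, n)) (B : 'M[C]_(p, q)) :
  (A + A') *t B = A *t B + A' *t B.
Proof. by apply/matrixP => i j; rewrite !mxE mulrDl. Qed.

Lemma tensmxDr m n p q (A : 'M[C]_(m, n)) (B B' : 'M[C]_(p, q)) :
  A *t (B + B') = A *t B + A *t B'.
Proof. by apply/matrixP => i j; rewrite !mxE mulrDr. Qed.

Lemma tensmxZl m n p q a (A : 'M[C]_(m, n)) (B : 'M[C]_(p, q)) :
  (a *: A) *t B = a *: (A *t B).
Proof. by apply/matrixP => i j; rewrite !mxE mulrA. Qed.

Lemma tensmxZr m n p q a (A : 'M[C]_(m, n)) (B : 'M[C]_(p, q)) :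
  A *t (a *: B) = a *: (A *t B).
Proof. by apply/matrixP => i j; rewrite !mxE mulrCA. Qed.

Lemma tensmx_sumr (I : finType) m n p q (A : 'M[C]_(m, n)) (B : I -> 'M[C]_(p, q)) :
  A *t (\sum_i B i) = \sum_i (A *t B i).
Proof.
by apply: (big_morph (tensmx A)) => [? ?|]; rewrite ?tensmxDr ?tensmx0.
Qed.

Lemma tensmx_suml (I : finType) m n p q (A : I -> 'M[C]_(m, n)) (B : 'M[C]_(p, q)) :
  (\sum_i A i) *t B = \sum_i (A i *t B).
Proof.
by apply: (big_morph (fun A => A *t B)) => [? ?|]; rewrite ?tensmxDl ?tens0mx.
Qed.

Lemma tensmx11 m n : (1%:M : 'M[C]_m) *t (1%:M : 'M[C]_n) = 1%:M.
Proof.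
apply: matrix_tensP => i j k l; rewrite tensmxE !mxE mxtens_index_eq.
by case: eqP; case: eqP; rewrite ?mulr1n ?mulr0n ?mulr1 ?mulr0 ?mul0r.
Qed.

End Regroup.

Section SeparableCone.
Context {C : numClosedFieldType}.

(** Rows stand for bras, so for [v] the bra of x this is the operator |x><x|. *)
Definition ketbra n (v : 'rV[C]_n) : 'M[C]_n := v^t* *m v.

Lemma ketbraE n (v : 'rV[C]_n) i j : ketbra v i j = (v 0 i)^* * v 0 j.
Proof. by rewrite mxE big_ord1 !mxE. Qed.

Lemma ketbraZ n a (v : 'rV[C]_n) : ketbra (a *: v) = (a^* * a) *: ketbra v.
Proof.
apply/matrixP => i j; rewrite [RHS]mxE !ketbraE !mxE rmorphM /=.
by ring.
Qed.

Lemma mxtrace_ketbra n (v : 'rV[C]_n) (Q : 'M[C]_n) :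
  \tr (Q *m ketbra v) = (v *m Q *m v^t*) 0 0.
Proof.
by rewrite /ketbra mulmxA mxtrace_mulC mulmxA trace_mx11.
Qed.

Definition tensrow m n (v : 'rV[C]_m) (w : 'rV[C]_n) : 'rV[C]_(m * n) :=
  \row_k (v 0 (mxtens_unindex k).1 * w 0 (mxtens_unindex k).2).

Lemma tensrowE m n (v : 'rV[C]_m) (w : 'rV[C]_n) i j :
  tensrow v w 0 (mxtens_index (i, j)) = v 0 i * w 0 j.
Proof. by rewrite mxE mxtens_indexK. Qed.

Lemma ketbra_tens m n (v : 'rV[C]_m) (w : 'rV[C]_n) :
  ketbra v *t ketbra w = ketbra (tensrow v w).
Proof.
apply: matrix_tensP => i j k l.
by rewrite tensmxE !ketbraE !tensrowE rmorphM /= mulrACA.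
Qed.

(** Separable operators without normalisation, generated by rank-one products. Sums and nonnegative
    multiples then need no bookkeeping of probabilities. *)
Definition sepcone m n (X : 'M[C]_(m * n)) : Prop :=
  exists (K : nat) (v : 'I_K -> 'rV[C]_m) (w : 'I_K -> 'rV[C]_n),
    X = \sum_k ketbra (v k) *t ketbra (w k).

Lemma sepcone_ketbra m n (v : 'rV[C]_m) (w : 'rV[C]_n) :
  sepcone (ketbra v *t ketbra w).
Proof. by exists 1, (fun=> v), (fun=> w); rewrite big_ord1. Qed.

Lemma sepcone0 m n : sepcone (0 : 'M[C]_(m * n)).
Proof. by exists 0, (fun=> 0), (fun=> 0); rewrite big_ord0. Qed.

Lemma sepconeD m n (X Y : 'M[C]_(m * n)) : sepcone X -> sepcone Y -> sepcone (X + Y).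
Proof.
move=> [K [v [w ->]]] [L [v' [w' ->]]].
exists (K + L)%N,
  (fun k : 'I_(K + L)%N => match fintype.split k with inl i => v i | inr i => v' i end),
  (fun k : 'I_(K + L)%N => match fintype.split k with inl i => w i | inr i => w' i end).
rewrite big_split_ord /=; congr (_ + _); apply: eq_bigr => k _.
  by have -> : fintype.split (lshift L k) = inl k by exact: (unsplitK (inl _ k)).
by have -> : fintype.split (rshift K k) = inr k by exact: (unsplitK (inr _ k)).
Qed.

Lemma sepcone_sum m n (I : finType) (P : pred I) (X : I -> 'M[C]_(m * n)) :
  (forall i, P i -> sepcone (X i)) -> sepcone (\sum_(i | P i) X i).
Proof.
by move=> h; elim/big_ind: _ => //; [exact: sepcone0|exact: sepconeD].
Qed.

Lemma sepconeZ m n a (X : 'M[C]_(m * n)) : 0 <= a -> sepcone X -> sepcone (a *: X).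
Proof.
move=> a0 [K [v [w ->]]]; rewrite scaler_sumr; apply: sepcone_sum => k _.
rewrite -tensmxZl -[a]sqrtCK expr2 -{1}(geC0_conj (x := sqrtC a)) ?sqrtC_ge0 //.
by rewrite -ketbraZ; exact: sepcone_ketbra.
Qed.

(** Regrouping sends the product of v (x) w and v' (x) w' to (v (x) v') (x) (w (x) w'), which is a
    product vector for the cut A1A2|B1B2. *)
Lemma sepcone_regroup m n (X Y : 'M[C]_(m * n)) :
  sepcone X -> sepcone Y -> sepcone (regroupmx (X *t Y)).
Proof.
move=> [K [v [w ->]]] [L [v' [w' ->]]].
rewrite tensmx_suml.
rewrite (big_morph (@regroupmx C m n) (@regroupmxD C m n) (@regroupmx0 C m n)).
apply: sepcone_sum => k _; rewrite tensmx_sumr.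
rewrite (big_morph (@regroupmx C m n) (@regroupmxD C m n) (@regroupmx0 C m n)).
apply: sepcone_sum => l _.
rewrite (_ : regroupmx _ = ketbra (tensrow (v k) (v' l)) *t ketbra (tensrow (w k) (w' l))).
  exact: sepcone_ketbra.
apply: matrix_tensP => a b a' b'.
case: (mxtens_indexP a) => a1 a2; case: (mxtens_indexP b) => b1 b2.
case: (mxtens_indexP a') => a1' a2'; case: (mxtens_indexP b') => b1' b2'.
rewrite mxE !regroupE !tensmxE !ketbraE !tensrowE !rmorphM /=.
by ring.
Qed.

End SeparableCone.

Section SeparableStates.
Context {R : realType}.
Local Notation C := R[i].

Lemma psdmx_ketbra n (v : 'rV[C]_n) : psdmx (ketbra v).
Proof.
split; first by apply/hermsymmxP; rewrite /ketbra trmxC_mul trmxCK.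
move=> w; rewrite /ketbra mulmxA -mulmxA.
have -> : v *m w^t* = (w *m v^t*)^t* by rewrite trmxC_mul trmxCK.
by rewrite mxE big_ord1 [X in _ * X]mxE [X in _ * _ X]mxE mul_conjC_ge0.
Qed.

Lemma psdmxD n (A B : 'M[C]_n) : psdmx A -> psdmx B -> psdmx (A + B).
Proof.
move=> [/hermsymmxP hA A0] [/hermsymmxP hB B0]; split.
  by apply/hermsymmxP; rewrite raddfD /= map_mxD -hA -hB.
by move=> v; rewrite mulmxDr mulmxDl mxE addr_ge0.
Qed.

Lemma psdmx0 n : psdmx (0 : 'M[C]_n).
Proof.
split; first by apply/hermsymmxP; rewrite trmx0 map_mx0.
by move=> v; rewrite mulmx0 mul0mx mxE.
Qed.

Lemma psdmx_sum n (I : finType) (F : I -> 'M[C]_n) :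
  (forall i, psdmx (F i)) -> psdmx (\sum_i F i).
Proof.
by move=> h; elim/big_ind: _ => //; [exact: psdmx0|exact: psdmxD].
Qed.

(** Spectral decomposition, each eigenvector absorbing the square root of its nonnegative
    eigenvalue. *)
Lemma psdmx_ketbra_sum n (A : 'M[C]_n) : psdmx A ->
  exists v : 'I_n -> 'rV[C]_n, A = \sum_k ketbra (v k).
Proof.
move=> [hA A0]; set P := spectralmx A; set D := spectral_diag A.
have D0 j : 0 <= D 0 j.
  have := A0 (row j P); rewrite -row_mul spectral_mulmx // mul_diag_mx -/P -/D.
  have -> : row j (\matrix_(i, k) (D 0 i * P i k)) = D 0 j *: row j P.
    by apply/rowP => k; rewrite !mxE.
  rewrite -scalemxAl; have /row_unitarymxP /(_ j j) := spectral_unitarymx A.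
  by rewrite dotmxE eqxx => e; rewrite [X in _ <= X]mxE e mulr1.
exists (fun k => sqrtC (D 0 k) *: row k P).
rewrite [LHS]hermitian_spectralP // -/P -/D.
apply/matrixP => i j; rewrite summxE -mulmxA mul_diag_mx mxE; apply: eq_bigr => k _.
rewrite ketbraZ geC0_conj ?sqrtC_ge0 // -expr2 sqrtCK [RHS]mxE ketbraE !mxE.
by ring.
Qed.

Lemma sepcone_psdmx m n (X : 'M[C]_(m * n)) : sepcone X -> psdmx X.
Proof.
move=> [K [v [w ->]]]; apply: psdmx_sum => k.
by rewrite ketbra_tens; exact: psdmx_ketbra.
Qed.

Lemma separable_sepcone m n (X : 'M[C]_(m * n)) : separable_state X -> sepcone X.
Proof.
move=> [K [p [rho [tau [p0 _ rhoD tauD ->]]]]].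
apply: sepcone_sum => k _; apply: sepconeZ; first by rewrite ler0c.
have [v ->] := psdmx_ketbra_sum (rhoD k).1.
have [w ->] := psdmx_ketbra_sum (tauD k).1.
rewrite tensmx_suml; apply: sepcone_sum => i _; rewrite tensmx_sumr.
by apply: sepcone_sum => j _; exact: sepcone_ketbra.
Qed.

Lemma separable_state_trace m n (X : 'M[C]_(m * n)) : separable_state X -> \tr X = 1.
Proof.
move=> [K [p [rho [tau [_ p1 rhoD tauD ->]]]]].
rewrite mxtrace_sum -[RHS](rmorph1 (real_complex R)) -p1 rmorph_sum /=.
apply: eq_bigr => k _.
by rewrite mxtraceZ mxtrace_tens (rhoD k).2 (tauD k).2 !mulr1.
Qed.

Definition sqnorm n (v : 'rV[C]_n) : R := complex.Re (\tr (ketbra v)).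

Lemma mxtrace_ketbraE n (v : 'rV[C]_n) : \tr (ketbra v) = \sum_i `|v 0 i| ^+ 2.
Proof.
by apply: eq_bigr => i _; rewrite ketbraE mulrC -normCK.
Qed.

Lemma sqnormE n (v : 'rV[C]_n) : (sqnorm v)%:C = \tr (ketbra v).
Proof.
by rewrite RRe_real // ger0_real // mxtrace_ketbraE sumr_ge0.
Qed.

Lemma sqnorm_ge0 n (v : 'rV[C]_n) : 0 <= sqnorm v.
Proof.
by rewrite -ler0c sqnormE mxtrace_ketbraE sumr_ge0.
Qed.

Lemma sqnorm_eq0 n (v : 'rV[C]_n) : sqnorm v = 0 -> v = 0.
Proof.
move=> h; have := sqnormE v; rewrite h mxtrace_ketbraE => /esym/eqP.
rewrite psumr_eq0 => [/allP e|i _]; last by rewrite exprn_ge0.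
apply/rowP => i; have := e i; rewrite mem_index_enum => /(_ isT).
by rewrite sqrf_eq0 normr_eq0 mxE => /eqP.
Qed.

Lemma normalize_ketbra n (v : 'rV[C]_n) : (0 < n)%N ->
  exists2 A : 'M[C]_n, density_matrix A & ketbra v = (sqnorm v)%:C *: A.
Proof.
move=> n0; have [v0|vn0] := eqVneq (sqnorm v) 0.
  (* The zero vector has no direction, so an arbitrary basis state carries weight 0. *)
  pose e : 'rV[C]_n := delta_mx 0 (Ordinal n0).
  exists (ketbra e).
    split; first exact: psdmx_ketbra.
    rewrite mxtrace_ketbraE (bigD1 (Ordinal n0)) //= big1 ?addr0 => [|i /negPf ni].
      by rewrite !mxE !eqxx /= normr1 expr1n.
    by rewrite !mxE ni andbF /= normr0 expr0n.
  by rewrite v0 scale0r (sqnorm_eq0 v0) /ketbra mulmx0.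
have q0 : 0 < sqnorm v by rewrite lt_neqAle eq_sym vn0 sqnorm_ge0.
exists ((sqnorm v)^-1%:C *: ketbra v); last first.
  by rewrite scalerA -rmorphM divff // scale1r.
split; last by rewrite mxtraceZ -sqnormE -rmorphM mulVf.
have [h1 h2] := psdmx_ketbra v; split.
  apply/hermsymmxP; rewrite linearZ /= map_mxZ /= -(hermsymmxP _ h1).
  by rewrite conj_Creal // complex_real.
move=> w; rewrite -scalemxAr -scalemxAl mxE mulr_ge0 //.
by rewrite ler0c invr_ge0 sqnorm_ge0.
Qed.

(** Normalising each factor moves the squared norms into the weights, which sum to the trace. *)
Lemma sepcone_separable m n (X : 'M[C]_(m * n)) : (0 < m)%N -> (0 < n)%N ->
  sepcone X -> \tr X = 1 -> separable_state X.
Proof.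
move=> m0 n0 [K [v [w XE]]] X1.
have [A AE] := choice (fun k =>
  let: ex_intro2 A h1 h2 := normalize_ketbra (v k) m0 in
  ex_intro (fun A => density_matrix A /\ ketbra (v k) = (sqnorm (v k))%:C *: A) A (conj h1 h2)).
have [B BE] := choice (fun k =>
  let: ex_intro2 A h1 h2 := normalize_ketbra (w k) n0 in
  ex_intro (fun A => density_matrix A /\ ketbra (w k) = (sqnorm (w k))%:C *: A) A (conj h1 h2)).
exists K, (fun k => sqnorm (v k) * sqnorm (w k)), A, B; split.
- by move=> k; rewrite mulr_ge0 ?sqnorm_ge0.
- apply: (@complexI R); rewrite rmorph_sum /= -[RHS]X1 XE mxtrace_sum.
  by apply: eq_bigr => k _; rewrite mxtrace_tens rmorphM /= !sqnormE.
- by move=> k; case: (AE k).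
- by move=> k; case: (BE k).
rewrite XE; apply: eq_bigr => k _; have [_ ->] := AE k; have [_ ->] := BE k.
by rewrite tensmxZl tensmxZr scalerA -rmorphM.
Qed.

End SeparableStates.

(** * Flips and their projectors *)

Section SwapProjectors.
Context {R : realType}.
Local Notation C := R[i].
Variable (d : nat).
Local Notation F := (@flip R d).

Lemma flipE (i j k l : 'I_d) :
  F (mxtens_index (i, j)) (mxtens_index (k, l)) = ((i == l) && (j == k))%:R.
Proof.
rewrite /flip summxE (bigD1 i) //= [X in _ + X]big1 ?addr0; last first.
  move=> i' ii'; rewrite summxE big1 // => j' _.
  by rewrite mxE !mxtens_index_eq [i == i']eq_sym (negPf ii').
rewrite summxE (bigD1 j) //= [X in _ + X]big1 ?addr0; last first.
  move=> j' jj'; rewrite mxE !mxtens_index_eq [j == j']eq_sym (negPf jj').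
  by rewrite andbF.
by rewrite mxE !mxtens_index_eq !eqxx /= andbC [l == i]eq_sym [k == j]eq_sym.
Qed.

Lemma sum_delta_mul (I : finType) (c : I) (f : I -> C) :
  \sum_i (i == c)%:R * f i = f c.
Proof.
rewrite (bigD1 c) //= eqxx mul1r big1 ?addr0 // => i /negPf ->.
by rewrite mul0r.
Qed.

Lemma flip_sq : F *m F = 1%:M.
Proof.
apply: matrix_tensP => i j k l; rewrite mxE sum_mxtens_index.
under eq_bigr => a _ do under eq_bigr => b _ do rewrite !flipE -!mulnb !natrM.
rewrite mxE mxtens_index_eq.
transitivity (\sum_a (a == j)%:R * \sum_b (b == i)%:R * ((a == l)%:R * (b == k)%:R) : C).
  apply: eq_bigr => a _; rewrite mulr_sumr; apply: eq_bigr => b _.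
  by rewrite [i == b]eq_sym [j == a]eq_sym; ring.
by rewrite sum_delta_mul sum_delta_mul -natrM mulnb andbC.
Qed.

Lemma trmxC_flip : F^t* = F.
Proof.
apply: matrix_tensP => i j k l; rewrite mxE mxE !flipE conjC_nat.
by rewrite andbC [k == j]eq_sym [l == i]eq_sym.
Qed.

Lemma mxtrace_flip : \tr F = d%:R.
Proof.
rewrite /mxtrace sum_mxtens_index.
under eq_bigr => i _.
  under eq_bigr => j _ do rewrite flipE [j == i]eq_sym andbb eq_sym -[_%:R]mulr1.
  rewrite sum_delta_mul; over.
by rewrite sumr_const card_ord.
Qed.

(* [true] stands for the symmetric subspace, [false] for the antisymmetric one. *)
Definition swap_proj (s : bool) : 'M[C]_(d * d) :=
  2^-1 *: (if s then 1%:M + F else 1%:M - F).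

Lemma swap_proj_mul s t :
  swap_proj s *m swap_proj t = if s == t then swap_proj s else 0.
Proof.
have half (A : 'M[C]_(d * d)) : 2^-1 *: (A *+ 2) = A.
  by rewrite -[A *+ 2]scaler_nat scalerA mulVf ?scale1r // pnatr_eq0.
rewrite /swap_proj -scalemxAl -scalemxAr.
case: s; case: t => /=;
  rewrite ?(mulmxDl, mulmxDr, mulmxN, mulNmx, mul1mx, mulmx1, flip_sq, opprK).
- by rewrite [F + 1%:M]addrC -mulr2n half.
- rewrite [X in _ *: (_ *: X)](_ : _ = 0) ?scaler0 //.
  by apply/matrixP => i j; rewrite !mxE; ring.
- rewrite [X in _ *: (_ *: X)](_ : _ = 0) ?scaler0 //.
  by apply/matrixP => i j; rewrite !mxE; ring.
by rewrite [- F + 1%:M]addrC -mulr2n half.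
Qed.

Lemma trmxC_swap_proj s : (swap_proj s)^t* = swap_proj s.
Proof.
rewrite /swap_proj linearZ /= map_mxZ /= fmorphV rmorph_nat; congr (_ *: _).
by case: s; [rewrite trmxCD|rewrite trmxCB]; rewrite trmx1 map_mx1 trmxC_flip.
Qed.

Lemma mxtrace_swap_proj s :
  \tr (swap_proj s) = ((d%:R * (d%:R + (-1) ^+ (~~ s)) / 2)%:C).
Proof.
rewrite /swap_proj mxtraceZ.
have -> : \tr (if s then 1%:M + F else 1%:M - F) =
    \tr (1%:M : 'M[C]_(d * d)) + (-1) ^+ (~~ s) * \tr F.
  by case: s; [rewrite mxtraceD|rewrite mxtraceB]; rewrite /= ?expr0 ?expr1 ?mul1r ?mulN1r.
rewrite mxtrace1 mxtrace_flip natrM !rmorphM rmorphD fmorphV rmorphXn rmorphN.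
rewrite rmorph1 !rmorph_nat /=.
by case: s => /=; field.
Qed.

Definition swap_projs (st : bool * bool) : 'M[C]_((d * d) * (d * d)) :=
  regroupmx (swap_proj st.1 *t swap_proj st.2).
Local Notation Q := swap_projs.

Lemma swap_projs_orth k l : Q k *m Q l = if k == l then Q k else 0.
Proof.
case: k l => [s t] [s' t']; rewrite /Q regroupmx_mul tensmx_mul !swap_proj_mul.
rewrite xpair_eqE /=; case: eqP => _ /=; last by rewrite tens0mx regroupmx0.
by case: eqP => _ //=; rewrite tensmx0 regroupmx0.
Qed.

Lemma trmxC_swap_projs k : (Q k)^t* = Q k.
Proof. by rewrite trmxC_regroup trmxC_tens !trmxC_swap_proj. Qed.

(** As [Q k] is a Hermitian idempotent, its expectation in [v] is the squared norm of [v *m Q k]. *)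
Lemma swap_projs_psd k : psdmx (Q k).
Proof.
split; first by apply/hermsymmxP; rewrite trmxC_swap_projs.
move=> v; have -> : v *m Q k *m v^t* = (v *m Q k) *m (v *m Q k)^t*.
  have h := swap_projs_orth k k; rewrite eqxx in h.
  by rewrite trmxC_mul trmxC_swap_projs mulmxA -[v *m Q k *m Q k]mulmxA h.
by rewrite mxE sumr_ge0 // => i _; rewrite [_^t* _ _]mxE [_^T _ _]mxE mul_conjC_ge0.
Qed.

Lemma Re_mxtrace_swap_projs s t : complex.Re (\tr (Q (s, t))) =
  (d%:R * (d%:R + (-1) ^+ (~~ s)) / 2) * (d%:R * (d%:R + (-1) ^+ (~~ t)) / 2).
Proof. by rewrite mxtrace_regroup mxtrace_tens !mxtrace_swap_proj -rmorphM. Qed.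

(** The eigenvalue of the Werner state on each subspace: the probability [(1 + eta) / 2] or
    [(1 - eta) / 2] over the rank [d (d + 1) / 2] or [d (d - 1) / 2]. *)
Definition werner_weight (eta : R) (s : bool) : R :=
  (1 + (-1) ^+ (~~ s) * eta) / (d%:R * (d%:R + (-1) ^+ (~~ s))).

Lemma werner_swap_proj eta : (1 < d)%N -> werner eta d =
  \sum_s (werner_weight eta s)%:C *: swap_proj s.
Proof.
move=> d1; rewrite big_bool /= /werner /swap_proj !scalerA.
have h1 : d%:R != 0 :> R by rewrite pnatr_eq0; case: d d1.
have h2 : d%:R - 1 != 0 :> R by rewrite subr_eq0 pnatr_eq1; case: d d1 => [|[]].
have h3 : d%:R + 1 != 0 :> R by rewrite natr1 pnatr_eq0.
have h4 : d%:R ^+ 3 - d%:R != 0 :> R.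
  by rewrite (_ : _ - _ = d%:R * (d%:R - 1) * (d%:R + 1)) ?mulf_neq0 //; ring.
set a := werner_weight eta true; set b := werner_weight eta false.
have -> : (2^-1 : C) = (2^-1 : R)%:C by rewrite fmorphV rmorph_nat.
rewrite -!rmorphM scalerDr scalerBr scalerDr !scalerA -!rmorphM /=.
rewrite addrACA -!scalerDl -scalerBl -rmorphD -rmorphB /=.
by congr (_%:C *: _ + _%:C *: _); rewrite /a /b /werner_weight /= ?expr0 ?expr1;
  field; rewrite h1 h2 h3 h4.
Qed.

Lemma two_copies_werner eta : (1 < d)%N -> two_copies (werner eta d) =
  mixmx Q (fun st => werner_weight eta st.1 * werner_weight eta st.2).
Proof.
move=> d1; rewrite /two_copies -/(regroupmx _) werner_swap_proj //.
rewrite tensmx_suml (big_morph (@regroupmx C d d) (@regroupmxD C d d) (@regroupmx0 C d d)).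
rewrite /mixmx -(pair_big xpredT xpredT (fun s t =>
  (werner_weight eta s * werner_weight eta t)%:C *: Q (s, t))) /=.
apply: eq_bigr => s _; rewrite tensmx_sumr.
rewrite (big_morph (@regroupmx C d d) (@regroupmxD C d d) (@regroupmx0 C d d)).
by apply: eq_bigr => t _; rewrite tensmxZl tensmxZr !regroupmxZ scalerA -rmorphM.
Qed.

End SwapProjectors.

(** * The flip inequality on separable operators *)

Section Witness.
Context {R : realType}.
Local Notation C := R[i].
Variable (d : nat).
Local Notation F := (@flip R d).
Local Notation F1 := (regroupmx (F *t 1%:M)).
Local Notation F2 := (regroupmx (1%:M *t F)).
Local Notation F12 := (regroupmx (F *t F)).
Local Notation idx4 a1 a2 b1 b2 :=
  (mxtens_index (mxtens_index (a1, a2), mxtens_index (b1, b2))).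

Lemma normsq_sum_le (z : 'I_d -> C) :
  `|\sum_j z j| ^+ 2 <= d%:R * \sum_j `|z j| ^+ 2.
Proof.
have [+ _] := CauchySchwarz (@dotmx C d) (\row_j z j) (const_mx 1).
rewrite /= !dotmxE; congr (`|_| ^+ 2 <= _).
  by rewrite mxE; apply: eq_bigr => j _; rewrite !mxE rmorph1 mulr1.
rewrite mulrC; congr (_ * _); rewrite mxE.
  by under eq_bigr => j _ do rewrite !mxE rmorph1 mulr1; rewrite sumr_const card_ord.
by apply: eq_bigr => j _; rewrite !mxE -normCK.
Qed.

Lemma flip1E (a1 a2 b1 b2 : 'I_d) y :
  F1 (idx4 a1 a2 b1 b2) y = (y == idx4 b1 a2 a1 b2)%:R.
Proof.
case: (mxtens_indexP y) => a b; case: (mxtens_indexP a) => x1 x2.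
case: (mxtens_indexP b) => y1 y2.
rewrite mxE !regroupE tensmxE flipE mxE !mxtens_index_eq -natrM mulnb.
by rewrite [x1 == _]eq_sym [x2 == _]eq_sym [y1 == _]eq_sym [y2 == _]eq_sym; do !case: eqP.
Qed.

Lemma flip2E (a1 a2 b1 b2 : 'I_d) y :
  F2 (idx4 a1 a2 b1 b2) y = (y == idx4 a1 b2 b1 a2)%:R.
Proof.
case: (mxtens_indexP y) => a b; case: (mxtens_indexP a) => x1 x2.
case: (mxtens_indexP b) => y1 y2.
rewrite mxE !regroupE tensmxE flipE mxE !mxtens_index_eq -natrM mulnb.
by rewrite [x1 == _]eq_sym [x2 == _]eq_sym [y1 == _]eq_sym [y2 == _]eq_sym; do !case: eqP.
Qed.

Lemma flip12E (a1 a2 b1 b2 : 'I_d) y :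
  F12 (idx4 a1 a2 b1 b2) y = (y == idx4 b1 b2 a1 a2)%:R.
Proof.
case: (mxtens_indexP y) => a b; case: (mxtens_indexP a) => x1 x2.
case: (mxtens_indexP b) => y1 y2.
rewrite mxE !regroupE tensmxE !flipE !mxtens_index_eq -natrM mulnb.
by rewrite [x1 == _]eq_sym [x2 == _]eq_sym [y1 == _]eq_sym [y2 == _]eq_sym; do !case: eqP.
Qed.

Lemma sum_idx4 (f : 'I_((d * d) * (d * d)) -> C) :
  \sum_x f x = \sum_a1 \sum_a2 \sum_b1 \sum_b2 f (idx4 a1 a2 b1 b2).
Proof.
rewrite !sum_mxtens_index; apply: eq_bigr => a1 _; apply: eq_bigr => a2 _.
by rewrite sum_mxtens_index.
Qed.

Section Product.
Variables (v w : 'rV[C]_(d * d)).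
Local Notation X := (ketbra v *t ketbra w).
(** Read [v] and [w] as matrices V and W indexed by the two copies. Then [g] is the transpose of V
    times the conjugate of W, and [h] is V times the adjoint of W; they have the same trace. Single
    flips give squared Frobenius norms of [g] and [h], the double flip their squared trace. *)
Let g (a2 b2 : 'I_d) := \sum_a1 v 0 (mxtens_index (a1, a2)) * (w 0 (mxtens_index (a1, b2)))^*.
Let h (a1 b1 : 'I_d) := \sum_a2 v 0 (mxtens_index (a1, a2)) * (w 0 (mxtens_index (b1, a2)))^*.

Lemma mxtrace_flip1 : \tr (F1 *m X) = \sum_a \sum_b `|g a b| ^+ 2.
Proof.
rewrite /mxtrace sum_idx4.
transitivity (\sum_a2 \sum_b2 \sum_a1 \sum_b1
   (v 0 (mxtens_index (a1, a2)) * (w 0 (mxtens_index (a1, b2)))^*) *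
   (v 0 (mxtens_index (b1, a2)) * (w 0 (mxtens_index (b1, b2)))^*)^*).
  rewrite exchange_big /=; apply: eq_bigr => a2 _.
  under eq_bigr => a1 _ do rewrite exchange_big /=.
  rewrite exchange_big /=; apply: eq_bigr => b2 _.
  apply: eq_bigr => a1 _; apply: eq_bigr => b1 _.
  rewrite mxE; under eq_bigr => y _ do rewrite flip1E.
  by rewrite sum_delta_mul tensmxE !ketbraE rmorphM /= conjCK; ring.
apply: eq_bigr => a2 _; apply: eq_bigr => b2 _.
rewrite normCK rmorph_sum mulr_suml; apply: eq_bigr => a1 _.
by rewrite mulr_sumr.
Qed.

Lemma mxtrace_flip2 : \tr (F2 *m X) = \sum_a \sum_b `|h a b| ^+ 2.
Proof.
rewrite /mxtrace sum_idx4.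
transitivity (\sum_a1 \sum_b1 \sum_a2 \sum_b2
   (v 0 (mxtens_index (a1, a2)) * (w 0 (mxtens_index (b1, a2)))^*) *
   (v 0 (mxtens_index (a1, b2)) * (w 0 (mxtens_index (b1, b2)))^*)^*).
  apply: eq_bigr => a1 _; rewrite exchange_big /=; apply: eq_bigr => b1 _.
  apply: eq_bigr => a2 _; apply: eq_bigr => b2 _.
  rewrite mxE; under eq_bigr => y _ do rewrite flip2E.
  by rewrite sum_delta_mul tensmxE !ketbraE rmorphM /= conjCK; ring.
apply: eq_bigr => a2 _; apply: eq_bigr => b2 _.
rewrite normCK rmorph_sum mulr_suml; apply: eq_bigr => a1 _.
by rewrite mulr_sumr.
Qed.

Lemma mxtrace_flip12 : \tr (F12 *m X) = `|\sum_a g a a| ^+ 2.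
Proof.
rewrite /mxtrace sum_idx4 /g normCK exchange_big /=.
rewrite rmorph_sum mulr_suml; apply: eq_bigr => a2 _.
rewrite mulr_suml; apply: eq_bigr => a1 _.
rewrite mulr_sumr exchange_big /=; apply: eq_bigr => b2 _.
rewrite rmorph_sum mulr_sumr; apply: eq_bigr => b1 _.
rewrite mxE; under eq_bigr => y _ do rewrite flip12E.
by rewrite sum_delta_mul tensmxE !ketbraE rmorphM /= conjCK; ring.
Qed.

Lemma sum_diag_sqnorm_le (f : 'I_d -> 'I_d -> C) :
  `|\sum_a f a a| ^+ 2 <= d%:R * \sum_a \sum_b `|f a b| ^+ 2.
Proof.
apply: (le_trans (normsq_sum_le (fun a => f a a))).
rewrite ler_wpM2l ?ler0n //; apply: ler_sum => a _.
by rewrite (bigD1 a) //= lerDl sumr_ge0 //.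
Qed.

Lemma mxtrace_flip12_le1 : \tr (F12 *m X) <= d%:R * \tr (F1 *m X).
Proof. by rewrite mxtrace_flip12 mxtrace_flip1 sum_diag_sqnorm_le. Qed.

Lemma mxtrace_flip12_le2 : \tr (F12 *m X) <= d%:R * \tr (F2 *m X).
Proof.
rewrite mxtrace_flip12 mxtrace_flip2.
have -> : \sum_a g a a = \sum_a h a a by rewrite /g /h exchange_big.
exact: sum_diag_sqnorm_le.
Qed.

End Product.

(* In terms of u and v this is [0 <= (d - 1) - 2 d u + (2 - d) v], the only separability
   constraint that is active at the optimum. *)
Lemma sepcone_flip_le (X : 'M[C]_((d * d) * (d * d))) : sepcone X ->
  2 * \tr (F12 *m X) <= d%:R * (\tr (F1 *m X) + \tr (F2 *m X)).
Proof.
move=> [K [v [w ->]]]; rewrite !mulmx_sumr !mxtrace_sum -big_split /= !mulr_sumr.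
apply: ler_sum => k _; rewrite mulrDr mulr2n mulrDl !mul1r.
by apply: lerD; [exact: mxtrace_flip12_le1|exact: mxtrace_flip12_le2].
Qed.

End Witness.

(** * Finite averages *)

Section Averages.
Context {C : numClosedFieldType}.
Variable d : nat.

(** In characteristic zero [X^n - 1] is separable, so it has n distinct roots; that many n-th roots
    of unity include a primitive one. *)
Lemma prim_root_exists n : (0 < n)%N -> exists z : C, n.-primitive_root z.
Proof.
move=> n0; pose p : {poly C} := 'X^n - 1; have [r Dp] := closed_field_poly_normal p.
rewrite (monicP _) ?monicXnsubC // scale1r in Dp.
have rn1 : all n.-unity_root r by apply/allP => z; rewrite -root_prod_XsubC -Dp.
have sz_r : (n < (size r).+1)%N.
  by rewrite -(size_prod_XsubC r id) -Dp size_XnsubC.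
have [|z] := hasP (has_prim_root n0 rn1 _ sz_r); last by exists z.
by rewrite -separable_prod_XsubC -Dp separable_Xn_sub_1 // pnatr_eq0 -lt0n.
Qed.

Lemma sum_expr_unity (z : C) : z ^+ d = 1 -> z != 1 -> \sum_(a < d) z ^+ a = 0.
Proof.
move=> zd z1; apply/eqP; have /eqP := subrX1 z d.
by rewrite zd subrr eq_sym mulf_eq0 subr_eq0 (negPf z1).
Qed.

(** Exponents of fourth roots of unity. Signs alone would not separate the index pairs (a, a) and
    (b, b), whereas exponent differences between -2 and 2 are distinguished modulo 4. *)
Definition phases := {ffun 'I_d -> 'I_4}.
Definition phase (f : phases) (a : 'I_d) : C := 'i ^+ f a.

Lemma phase_add (f g : phases) a : phase (f + g) a = phase f a * phase g a.
Proof.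
have i4 : ('i : C) ^+ 4 = 1 by rewrite (exprM _ 2 2) sqrCi sqrrN expr1n.
by rewrite /phase -exprD ffunE /= (expr_mod _ i4).
Qed.

Lemma phase_conj (f : phases) a : (phase f a)^* * phase f a = 1.
Proof.
by rewrite /phase -normCKC normrX normCi !expr1n.
Qed.

Definition phase_corr (a b a' b' : 'I_d) : C := \sum_(f : phases)
  (phase f a * phase f b)^* * (phase f a' * phase f b').

Lemma phase_corr_same a b : phase_corr a b a b = #|phases|%:R.
Proof.
rewrite /phase_corr -sum1_card natr_sum; apply: eq_bigr => f _.
by rewrite rmorphM mulrACA !phase_conj mulr1.
Qed.

Lemma phase_corr_swap a b : phase_corr a b b a = #|phases|%:R.
Proof.
rewrite -(phase_corr_same a b); apply: eq_bigr => f _.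
by rewrite [phase f b * _]mulrC.
Qed.

(** Shifting the phase at [c] by ['i] permutes the summands and multiplies the sum by a power [t] of
    ['i] with exponent 1, -1, 2 or -2. As [t] differs from 1, the sum is zero. *)
Lemma phase_corr0 (a b a' b' c : 'I_d) :
  ((a == c) + (b == c) != (a' == c) + (b' == c))%N -> phase_corr a b a' b' = 0.
Proof.
move=> ne; pose g : phases := [ffun x => if x == c then 1 else 0].
have pg x : phase g x = 'i ^+ (x == c) by rewrite /phase ffunE; case: eqP.
pose t : C := ('i ^+ ((a == c) + (b == c)))^* * 'i ^+ ((a' == c) + (b' == c)).
have e : phase_corr a b a' b' = t * phase_corr a b a' b'.
  rewrite {1}/phase_corr (reindex_inj (addIr g)) mulr_sumr /=.
  apply: eq_bigr => f _; rewrite !phase_add !pg /t !exprD !rmorphM /=.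
  by ring.
have : (1 - t) * phase_corr a b a' b' = 0 by rewrite mulrBl mul1r -e subrr.
move/eqP; rewrite mulf_eq0 => /orP[|/eqP //].
rewrite subr_eq0 => /eqP t1; exfalso; move: ne t1; rewrite /t.
have i1 : ('i : C) != 1.
  apply/eqP => h; have := sqrCi C; rewrite h expr1n => /eqP.
  by rewrite -subr_eq0 opprK -[1 + 1]/(2%:R) pnatr_eq0.
have i2 : (1 : C) != -1 by rewrite -subr_eq0 opprK -[1 + 1]/(2%:R) pnatr_eq0.
have i3 : ('i : C) != -1.
  apply/eqP => h; have := sqrCi C; rewrite h sqrrN expr1n => /eqP.
  by rewrite (negPf i2).
have ci : ('i : C)^* = - 'i by exact: conjCi.
have ii : ('i : C) * 'i = -1 by rewrite -expr2 sqrCi.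
case: (a == c); case: (b == c); case: (a' == c); case: (b' == c) => //= _;
  rewrite ?expr0 ?expr1 ?expr2 ?rmorphM ?rmorph1 /= ?ci ?mulrNN ?ii
    ?mul1r ?mulr1 ?mulN1r ?mulrN1 ?opprK => h;
  (try by move: i1; rewrite -h eqxx); (try by move: i1; rewrite h eqxx);
  (try by move: i2; rewrite -h eqxx); (try by move: i2; rewrite h eqxx);
  (try by move: i3; rewrite -h eqxx); (try by move: i3; rewrite -[X in _ == X]h opprK eqxx);
  (try by move: i3; rewrite -[X in X == _]opprK h eqxx).
Qed.

(** Only equal unordered pairs survive: otherwise some index has different multiplicities in the two
    pairs, and [phase_corr0] applies there. *)
Lemma phase_corrE (a b a' b' : 'I_d) : phase_corr a b a' b' =
  (((a == a') && (b == b')) || ((a == b') && (b == a')))%:R * #|phases|%:R.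
Proof.
have [/andP[/eqP <- /eqP <-]|n1] := boolP ((a == a') && (b == b')).
  by rewrite phase_corr_same mul1r.
have [/andP[/eqP <- /eqP <-]|n2] := boolP ((a == b') && (b == a')).
  by rewrite phase_corr_swap mul1r.
rewrite mul0r.
have [/negPf aa|] := boolP (a != a'); last rewrite negbK => /eqP ea.
  have [/negPf ab|] := boolP (a != b'); last rewrite negbK => /eqP ea.
    apply: (@phase_corr0 _ _ _ _ a).
    by rewrite eqxx [a' == a]eq_sym [b' == a]eq_sym aa ab; case: (b == a).
  subst b'; move: n2; rewrite eqxx /= => /negPf n2.
  by apply: (@phase_corr0 _ _ _ _ a'); rewrite eqxx aa n2.
subst a'; move: n1; rewrite eqxx /= => /negPf n1.
apply: (@phase_corr0 _ _ _ _ b'); rewrite eqxx n1; move: n2.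
by case: (a == b') => //=; rewrite eq_sym => /negPf ->.
Qed.

Local Open Scope group_scope.
Lemma perm_pair_exists (j l a b : 'I_d) : j != l -> a != b ->
  exists p : 'S_d, p j = a /\ p l = b.
Proof.
(* The first transposition takes [j] to [a]; the second takes the image of [l] to [b] and fixes
   [a]. *)
move=> jl ab; exists (tperm j a * tperm (tperm j a l) b)%g.
have la : tperm j a l != a.
  by rewrite -{2}(tpermL j a) (inj_eq perm_inj) eq_sym.
have ba : b != a by rewrite eq_sym.
by split; rewrite permM tpermL // (tpermD la ba).
Qed.
Local Close Scope group_scope.

Lemma sum_perm1 (g : 'I_d -> C) j :
  d%:R * (\sum_(q : 'S_d) g (q j)) = #|'S_d|%:R * \sum_a g a.
Proof.
transitivity (\sum_(a : 'I_d) \sum_(q : 'S_d) g (q a)).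
  rewrite [RHS](eq_bigr (fun=> \sum_(q : 'S_d) g (q j))); last first.
    move=> a _; rewrite (reindex_inj (mulgI (tperm a j))) /=.
    by apply: eq_bigr => q _; rewrite permM tpermL.
  by rewrite sumr_const card_ord mulr_natl.
rewrite exchange_big /= (eq_bigr (fun=> \sum_a g a)); last first.
  by move=> q _; rewrite [RHS](reindex_inj (@perm_inj _ q)).
by rewrite sumr_const mulr_natl; congr (_ *+ _); apply: eq_card => q; rewrite !inE.
Qed.

(** By double transitivity the permutation sum is the same for every pair of distinct indices;
    summing over all [d (d - 1)] such pairs and exchanging the sums gives the claim. *)
Lemma sum_perm2 (g : 'I_d -> 'I_d -> C) j l : j != l ->
  (d%:R * (d%:R - 1)) * (\sum_(q : 'S_d) g (q j) (q l))
  = #|'S_d|%:R * \sum_a \sum_(b | a != b) g a b.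
Proof.
move=> jl; transitivity (\sum_(a : 'I_d) \sum_(b | a != b) \sum_(q : 'S_d) g (q a) (q b)).
  rewrite [RHS](eq_bigr (fun=> (d%:R - 1) * \sum_(q : 'S_d) g (q j) (q l))).
    by rewrite sumr_const card_ord -[RHS]mulr_natl mulrA.
  move=> a _; rewrite (eq_bigr (fun=> \sum_(q : 'S_d) g (q j) (q l))).
    rewrite sumr_const -[LHS]mulr_natl; congr (_ * _).
    have := cardC1 a; rewrite card_ord => h.
    rewrite (eq_card (B := predC1 a)) ?h; last by move=> x; rewrite !inE eq_sym.
    by case: (d) a h => [[]//|n] _ _; rewrite -natr1 addrK.
  move=> b ab; have [p [<- <-]] := perm_pair_exists jl ab.
  rewrite [RHS](reindex_inj (mulgI p)) /=.
  by apply: eq_bigr => q _; rewrite !permM.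
under eq_bigr => a _ do rewrite exchange_big /=.
rewrite exchange_big /= (eq_bigr (fun=> \sum_a \sum_(b | a != b) g a b)).
  by rewrite sumr_const mulr_natl; congr (_ *+ _); apply: eq_card => q; rewrite !inE.
move=> q _; rewrite [RHS](reindex_inj (@perm_inj _ q)) /=; apply: eq_bigr => a _.
rewrite [RHS](reindex_inj (@perm_inj _ q)) /=.
by apply: eq_bigl => b; rewrite (inj_eq perm_inj).
Qed.

End Averages.

(** * Separable building blocks *)

Section UnitaryDesign.
Context {R : realType}.
Local Notation C := R[i].
Variable (d : nat).
Hypothesis d_gt1 : (1 < d)%N.
Local Notation F := (@flip R d).
Local Notation F1 := (regroupmx (F *t 1%:M)).
Local Notation F2 := (regroupmx (1%:M *t F)).
Local Notation F12 := (regroupmx (F *t F)).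
Local Notation idx4 a1 a2 b1 b2 :=
  (mxtens_index (mxtens_index (a1, a2), mxtens_index (b1, b2))).
Local Notation D := (#|'S_d|%:R : C).

(* A bipartite vector is read as a matrix: this is [N] with its columns permuted by [q]
   and its rows and columns multiplied by the phases [f] and [g]. *)
Definition design_row (N : 'I_d -> 'I_d -> C) (q : 'S_d) (f g : phases d) : 'rV[C]_(d * d) :=
  \row_k (phase f (mxtens_unindex k).1 * phase g (mxtens_unindex k).2
          * N (mxtens_unindex k).1 (q (mxtens_unindex k).2)).

Definition design N : 'M[C]_((d * d) * (d * d)) := \sum_q \sum_f \sum_g
  ketbra (design_row N q f g) *t ketbra (design_row N q f g).

Lemma sepcone_design N : sepcone (design N).
Proof. by do 3!(apply: sepcone_sum => ? _); exact: sepcone_ketbra. Qed.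

(** Row phases, column phases and permutations are summed independently, so each entry factors into
    two phase correlations and one permutation sum. *)
Lemma designE N i j k l i' j' k' l' :
  design N (idx4 i j k l) (idx4 i' j' k' l') =
  phase_corr i k i' k' * phase_corr j l j' l' *
  \sum_(q : 'S_d) (N i (q j) * N k (q l))^* * (N i' (q j') * N k' (q l')).
Proof.
rewrite /design summxE mulr_sumr; apply: eq_bigr => q _.
rewrite summxE /phase_corr mulr_suml mulr_suml; apply: eq_bigr => f _.
rewrite summxE mulr_sumr mulr_suml; apply: eq_bigr => g _.
rewrite tensmxE !ketbraE !mxE !mxtens_indexK /= !rmorphM /=.
by ring.
Qed.

(* [d^3 (d^2 - 1)] times the twirl of maximally entangled states of A1A2 and B1B2. *)
Definition full_swap_op : 'M[C]_((d * d) * (d * d)) := d%:R *: (1%:M + F12) - F1 - F2.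

Lemma full_swap_opE i j k l i' j' k' l' :
  full_swap_op (idx4 i j k l) (idx4 i' j' k' l') =
  d%:R * (((i == i') && (k == k') && ((j == j') && (l == l')))%:R +
          ((i == k') && (k == i') && ((j == l') && (l == j')))%:R)
  - ((i == k') && (k == i') && ((j == j') && (l == l')))%:R
  - ((i == i') && (k == k') && ((j == l') && (l == j')))%:R.
Proof.
rewrite [LHS]mxE [X in X + _]mxE [X in X + _ + _]mxE [X in _ + X + _]mxE [X in _ + X]mxE.
rewrite [X in _ * X]mxE flip1E flip2E flip12E [X in _ * (X + _)]mxE !mxtens_index_eq.
rewrite ![i' == _]eq_sym ![j' == _]eq_sym ![k' == _]eq_sym ![l' == _]eq_sym.
congr (_ * (_%:R + _%:R) - _%:R - _%:R).
- by do 4!case: (_ == _).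
- by do 4!case: (_ == _).
- by do 4!case: (_ == _).
by do 4!case: (_ == _).
Qed.

(** The permutation sums left after phase averaging: [corr_diag] when rows and columns are both kept
    or both exchanged, [corr_cross] when exactly one of the pairs is exchanged. *)
Definition corr_diag (N : 'I_d -> 'I_d -> C) i k j l :=
  \sum_(q : 'S_d) (N i (q j) * N k (q l))^* * (N i (q j) * N k (q l)).
Definition corr_cross (N : 'I_d -> 'I_d -> C) i k j l :=
  \sum_(q : 'S_d) (N i (q j) * N k (q l))^* * (N k (q j) * N i (q l)).

Definition id_entries (i j : 'I_d) : C := (i == j)%:R.

Let D0 : D != 0.
Proof. by rewrite pnatr_eq0 -lt0n; apply/card_gt0P; exists 1%g; rewrite inE. Qed.

Let d0 : d%:R != 0 :> C.
Proof. by rewrite pnatr_eq0; case: d d_gt1. Qed.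

Let d1 : d%:R - 1 != 0 :> C.
Proof. by rewrite subr_eq0 pnatr_eq1; case: d d_gt1 => [|[]]. Qed.

Lemma sum_offdiag (g : 'I_d -> 'I_d -> C) :
  \sum_a \sum_(b | a != b) g a b = \sum_a \sum_b g a b - \sum_a g a a.
Proof.
rewrite -sumrB; apply: eq_bigr => a _; rewrite [X in _ = X - _](bigD1 a) //=.
by rewrite addrC addrK; apply: eq_bigl => b; rewrite eq_sym.
Qed.

Lemma corr_diag_id i k j l : corr_diag id_entries i k j l =
  D / d%:R * ((i == k) && (j == l))%:R + D / (d%:R * (d%:R - 1)) * ((i != k) && (j != l))%:R.
Proof.
rewrite /corr_diag /id_entries.
under eq_bigr => q _ do rewrite rmorphM !rmorph_nat -!natrM !mulnb andbb.
have [<-|jl] := eqVneq j l.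
  rewrite andbF mulr0 addr0 andbT.
  have [<-|ik] := eqVneq i k; last first.
    rewrite mulr0 big1 // => q _.
    by case: eqP => //= iq; rewrite -iq eq_sym (negPf ik).
  have := sum_perm1 (fun a => ((i == a) && (i == a))%:R : C) j => h.
  apply: (mulfI d0); rewrite h mulr1 [RHS]mulrC divfK // -[RHS]mulr1; congr (_ * _).
  rewrite (bigD1 i) //= eqxx big1 ?addr0 // => a; rewrite eq_sym => /negPf ->.
  by [].
rewrite andbF andbT mulr0 add0r.
apply: (mulfI (mulf_neq0 d0 d1)).
have -> := sum_perm2 (fun a b => ((i == a) && (k == b))%:R : C) jl.
rewrite sum_offdiag.
have -> : \sum_a \sum_b ((i == a) && (k == b))%:R = 1 :> C.
  transitivity (\sum_a (a == i)%:R * \sum_b (b == k)%:R * 1 : C).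
    apply: eq_bigr => a _; rewrite mulr_sumr; apply: eq_bigr => b _.
    by rewrite mulr1 -natrM mulnb [a == i]eq_sym [b == k]eq_sym.
  by rewrite !sum_delta_mul.
have -> : \sum_a ((i == a) && (k == a))%:R = (i == k)%:R :> C.
  transitivity (\sum_a (a == i)%:R * (k == a)%:R : C).
    by apply: eq_bigr => a _; rewrite -natrM mulnb [a == i]eq_sym.
  by rewrite sum_delta_mul eq_sym.
rewrite mulrA [_ * (D / _)]mulrC divfK ?mulf_neq0 //; congr (_ * _).
by case: (i == k); rewrite ?subrr ?subr0.
Qed.

Lemma corr_cross_id i k j l : (i != k) || (j != l) ->
  corr_cross id_entries i k j l = 0.
Proof.
move=> h; rewrite /corr_cross /id_entries big1 // => q _.
rewrite rmorphM !rmorph_nat -!natrM !mulnb.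
case: (i =P q j) => //= ij; case: (k =P q l) => //= kl.
rewrite ij kl !(inj_eq perm_inj); move: h; rewrite ij kl !(inj_eq perm_inj) orbb.
by rewrite [l == j]eq_sym => /negPf ->.
Qed.

Variable w : C.
Hypothesis w_prim : d.-primitive_root w.
Definition fourier_entries (i j : 'I_d) : C := w ^+ (i * j).

Let conj_w : w^* * w = 1.
Proof.
have d_gt0 : (0 < d)%N by exact: ltnW.
rewrite -normCKC; have /eqP := prim_expr_order w_prim.
move/eqP/(congr1 Num.norm); rewrite normrX normr1 => /eqP.
by rewrite pexpr_eq1 // => /eqP ->; rewrite expr1n.
Qed.

Lemma fourier_unimod i j : (fourier_entries i j)^* * fourier_entries i j = 1.
Proof. by rewrite /fourier_entries rmorphXn -exprMn conj_w expr1n. Qed.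

Lemma corr_diag_fourier i k j l : corr_diag fourier_entries i k j l = D.
Proof.
rewrite /corr_diag; transitivity (\sum_(q : 'S_d) (1 : C)).
  by apply: eq_bigr => q _; rewrite rmorphM mulrACA !fourier_unimod mulr1.
by rewrite sumr_const; congr (_ *+ _); apply: eq_card => q; rewrite !inE.
Qed.

Lemma corr_cross_fourier_eq i k j l : (i == k) || (j == l) ->
  corr_cross fourier_entries i k j l = D.
Proof.
move=> h; rewrite -(corr_diag_fourier i k j l); apply: eq_bigr => q _.
congr (_ * _); case/orP: h => /eqP ->; first by [].
by rewrite mulrC.
Qed.

(** Here [z] is a nontrivial d-th root of unity, so its powers sum to 0. The sum over distinct pairs
    is minus the diagonal, that is [-d], and [sum_perm2] divides it by [d (d - 1)]. *)
Lemma corr_cross_fourier i k j l : i != k -> j != l ->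
  corr_cross fourier_entries i k j l = - (D / (d%:R - 1)).
Proof.
move=> ik jl; rewrite /corr_cross /fourier_entries.
pose z := (w ^+ i)^* * w ^+ k.
have zd : z ^+ d = 1.
  have wd (m : nat) : (w ^+ m) ^+ d = 1.
    by rewrite -exprM mulnC exprM (prim_expr_order w_prim) expr1n.
  by rewrite exprMn -rmorphXn /= !wd rmorph1 mulr1.
have cwi (m : nat) : (w ^+ m)^* * w ^+ m = 1 by rewrite rmorphXn -exprMn conj_w expr1n.
have z1 : z != 1.
  apply: contraNneq ik => z1.
  have : w ^+ i = w ^+ k by rewrite -[LHS]mulr1 -z1 /z mulrA [_ * _^*]mulrC cwi mul1r.
  move/eqP; rewrite (eq_prim_root_expr w_prim) !modn_small //.
pose g (a b : 'I_d) : C := z ^+ a * z^* ^+ b.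
apply: (mulfI (mulf_neq0 d0 d1)).
transitivity (d%:R * (d%:R - 1) * \sum_(q : 'S_d) g (q j) (q l)).
  congr (_ * _); apply: eq_bigr => q _.
  rewrite /g /z !exprM !rmorphM /= conjCK !exprMn !rmorphXn /=.
  by ring.
rewrite (sum_perm2 g jl) sum_offdiag.
have -> : \sum_a \sum_b g a b = 0.
  rewrite big1 // => a _; rewrite /g -mulr_sumr.
  by rewrite sum_expr_unity ?mulr0 ?fmorph_eq1 // -rmorphXn /= zd rmorph1.
have -> : \sum_a g a a = d%:R.
  transitivity (\sum_(a < d) (1 : C)); last by rewrite sumr_const card_ord.
  apply: eq_bigr => a _; rewrite /g -exprMn /z rmorphM /= conjCK mulrACA.
  by rewrite cwi mul1r mulrC cwi expr1n.
by field; rewrite d1.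
Qed.

(** The weights come from matching entries. For distinct rows and columns, the kept entries give
    [1 + (d - 1) = d] and the crossed ones [0 - 1 = -1]. With both rows and columns equal, each
    family gives [d - 1], in total [2 d - 2]. *)
Lemma full_swap_op_design :
  (#|phases d|%:R ^+ 2 : C) *: full_swap_op =
  (d%:R * (d%:R - 1) / D) *: design id_entries
  + ((d%:R - 1) / D) *: design fourier_entries.
Proof.
apply: matrix_tensP => a b a' b'.
case: (mxtens_indexP a) => i j; case: (mxtens_indexP b) => k l.
case: (mxtens_indexP a') => i' j'; case: (mxtens_indexP b') => k' l'.
rewrite [LHS]mxE [RHS]mxE [X in _ = X + _]mxE [X in _ = _ + X]mxE !designE full_swap_opE.
rewrite !phase_corrE.
have [/andP[/eqP <- /eqP <-]|nAs] := boolP ((i == i') && (k == k')).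
  have [/andP[/eqP <- /eqP <-]|nBs] := boolP ((j == j') && (l == l')).
    rewrite -/(corr_diag _ i k j l) -/(corr_diag _ i k j l).
    rewrite corr_diag_id corr_diag_fourier [k == i]eq_sym [l == j]eq_sym !andbb.
    by case: (i == k); case: (j == l) => /=; field; rewrite D0 d0 d1.
  have [/andP[/eqP jl /eqP lj]|nBw] := boolP ((j == l') && (l == j')); last first.
    by rewrite !andbF /=; ring.
  have jl' : j != l by move: nBs; rewrite -jl -lj eq_sym andbb eq_sym.
  rewrite -jl -lj.
  have cE N : \sum_(q : 'S_d) (N i (q j) * N k (q l))^* * (N i (q l) * N k (q j))
     = corr_cross N i k j l.
    by apply: eq_bigr => q _; rewrite [N k _ * N i _]mulrC.
  rewrite !cE corr_cross_id ?jl' ?orbT // [k == i]eq_sym !andbb.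
  have [ik|ik] := eqVneq i k.
    by rewrite corr_cross_fourier_eq ?ik ?eqxx //=; field; rewrite D0.
  by rewrite corr_cross_fourier //=; field; rewrite D0 d1.
have [/andP[/eqP ik /eqP ki]|nAw] := boolP ((i == k') && (k == i')); last first.
  by rewrite /=; ring.
have ik' : i != k by move: nAs; rewrite -ik -ki eq_sym andbb eq_sym.
rewrite -ik -ki.
have [/andP[/eqP <- /eqP <-]|nBs] := boolP ((j == j') && (l == l')).
  have cE N : \sum_(q : 'S_d) (N i (q j) * N k (q l))^* * (N k (q j) * N i (q l))
     = corr_cross N i k j l by [].
  rewrite !cE corr_cross_id ?ik' // [l == j]eq_sym !andbb.
  have [jl|jl] := eqVneq j l.
    by rewrite corr_cross_fourier_eq ?jl ?eqxx ?orbT //=; field; rewrite D0.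
  by rewrite corr_cross_fourier //=; field; rewrite D0 d1.
have [/andP[/eqP jl /eqP lj]|nBw] := boolP ((j == l') && (l == j')); last first.
  by rewrite /=; ring.
have jl' : j != l by move: nBs; rewrite -jl -lj eq_sym andbb eq_sym.
rewrite -jl -lj.
have cE N : \sum_(q : 'S_d) (N i (q j) * N k (q l))^* * (N k (q l) * N i (q j))
   = corr_diag N i k j l.
  by apply: eq_bigr => q _; rewrite [N k _ * N i _]mulrC.
rewrite !cE corr_diag_id corr_diag_fourier (negPf ik') (negPf jl') /=.
by field; rewrite D0 d0 d1.
Qed.

End UnitaryDesign.

Section SeparableBuildingBlocks.
Context {R : realType}.
Local Notation C := R[i].
Variable (d : nat).
Hypothesis d_gt1 : (1 < d)%N.
Local Notation F := (@flip R d).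

Let phases_gt0 : 0 < #|phases d|%:R :> C.
Proof. by rewrite ltr0n; apply/card_gt0P; exists 0. Qed.

Lemma sepcone_full_swap_op : sepcone (@full_swap_op R d).
Proof.
have [w w_prim] := @prim_root_exists C d (ltnW d_gt1).
have e : @full_swap_op R d =
    (#|phases d|%:R ^+ 2)^-1 *: ((#|phases d|%:R ^+ 2 : C) *: full_swap_op d).
  by rewrite scalerA mulVf ?scale1r // expf_neq0 // gt_eqF.
have d1 : 0 <= d%:R - 1 :> C by rewrite subr_ge0 ler1n ltnW.
rewrite e (full_swap_op_design d_gt1 w_prim); apply: sepconeZ.
  by rewrite invr_ge0 exprn_ge0 // ltW.
apply: sepconeD; apply: sepconeZ; try exact: sepcone_design.
  by rewrite divr_ge0 ?mulr_ge0 ?ler0n.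
by rewrite divr_ge0 ?ler0n.
Qed.

(** For [e] equal to 1 or -1 these are phased vectors e_i + e_k and e_i - e_k. Tensoring one of each
    sign yields the negative coefficient of the flip. *)
Definition sign_row (e : C) (i k : 'I_d) (f : phases d) : 'rV[C]_d :=
  \row_a (phase f a * ((a == i)%:R + e * (a == k)%:R)).

Definition basis_row (i : 'I_d) : 'rV[C]_d := delta_mx 0 i.

Definition sign_corr (a a' b b' : 'I_d) : C := \sum_i \sum_k
  (((a == i)%:R + (a == k)%:R) * ((a' == i)%:R + (a' == k)%:R)
   * (((b == i)%:R - (b == k)%:R) * ((b' == i)%:R - (b' == k)%:R))).

Lemma sum_delta2 (a b : 'I_d) : \sum_i \sum_k (a == i)%:R * (b == k)%:R = 1 :> C.
Proof.
transitivity (\sum_i (i == a)%:R * \sum_k (k == b)%:R * 1 : C).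
  apply: eq_bigr => i _; rewrite mulr_sumr; apply: eq_bigr => k _.
  by rewrite mulr1 [a == i]eq_sym [b == k]eq_sym.
by rewrite !sum_delta_mul.
Qed.

Lemma sign_corr_diag a : sign_corr a a a a = 2 * (d%:R - 1).
Proof.
transitivity (\sum_i \sum_k ((a == i)%:R * 1 + (a == k)%:R * 1
    - 2 * ((a == i)%:R * (a == k)%:R)) : C).
  apply: eq_bigr => i _; apply: eq_bigr => k _.
  by case: (a == i); case: (a == k) => /=; ring.
under eq_bigr => i _ do rewrite sumrB big_split /= sumr_const card_ord -mulr_sumr.
rewrite sumrB big_split /= -mulr_sumr sum_delta2.
have e : \sum_(i < d) (a == i)%:R * 1 = 1 :> C.
  by under eq_bigr => i _ do rewrite [a == i]eq_sym; rewrite sum_delta_mul.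
rewrite sumrMnl e sumr_const card_ord.
by ring.
Qed.

Lemma sign_corr_same a b : a != b -> sign_corr a a b b = 2.
Proof.
move=> ab; transitivity (\sum_i \sum_k ((a == i)%:R * (b == k)%:R + (b == i)%:R * (a == k)%:R) : C).
  apply: eq_bigr => i _; apply: eq_bigr => k _.
  have : ~~ ((a == i) && (b == i)) by apply: contraNN ab => /andP[/eqP -> /eqP ->].
  have : ~~ ((a == k) && (b == k)) by apply: contraNN ab => /andP[/eqP -> /eqP ->].
  by case: (a == i); case: (a == k); case: (b == i); case: (b == k) => //= _ _; ring.
under eq_bigr => i _ do rewrite big_split /=.
by rewrite big_split /= !sum_delta2.
Qed.

Lemma sign_corr_swap a b : a != b -> sign_corr a b b a = - 2.
Proof.
move=> ab; transitivity
  (- \sum_i \sum_k ((a == i)%:R * (b == k)%:R + (b == i)%:R * (a == k)%:R) : C).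
  rewrite -sumrN; apply: eq_bigr => i _; rewrite -sumrN; apply: eq_bigr => k _.
  have : ~~ ((a == i) && (b == i)) by apply: contraNN ab => /andP[/eqP -> /eqP ->].
  have : ~~ ((a == k) && (b == k)) by apply: contraNN ab => /andP[/eqP -> /eqP ->].
  by case: (a == i); case: (a == k); case: (b == i); case: (b == k) => //= _ _; ring.
under eq_bigr => i _ do rewrite big_split /=.
by rewrite big_split /= !sum_delta2.
Qed.

(** The operator is a multiple of the Werner state at [eta = 0]. The phased vectors produce the flip
    entries and the correct diagonal at (a, a); the basis products top up the diagonal at (a, b)
    with a != b from 2 to [2 d]. *)
Lemma dI_sub_flip_decomp : (2 * #|phases d|%:R : C) *: (d%:R *: 1%:M - F) =
  \sum_i \sum_k \sum_f ketbra (sign_row 1 i k f) *t ketbra (sign_row (-1) i k f)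
  + (2 * (d%:R - 1) * #|phases d|%:R) *:
    \sum_i \sum_(k | i != k) ketbra (basis_row i) *t ketbra (basis_row k).
Proof.
apply: matrix_tensP => a b a' b'.
rewrite [LHS]mxE [RHS]mxE [X in _ = _ + X]mxE.
have -> : (\sum_i \sum_k \sum_f ketbra (sign_row 1 i k f) *t ketbra (sign_row (-1) i k f))
    (mxtens_index (a, b)) (mxtens_index (a', b')) =
    phase_corr a b a' b' * sign_corr a a' b b'.
  rewrite summxE mulr_sumr; apply: eq_bigr => i _.
  rewrite summxE mulr_sumr; apply: eq_bigr => k _.
  rewrite summxE /phase_corr mulr_suml; apply: eq_bigr => f _.
  rewrite tensmxE !ketbraE !mxE !mul1r !mulN1r !rmorphM !rmorphD !rmorphN !rmorph_nat /=.
  by ring.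
have -> : (\sum_i \sum_(k | i != k) ketbra (basis_row i) *t ketbra (basis_row k))
    (mxtens_index (a, b)) (mxtens_index (a', b')) =
    ((a == a') && (b == b') && (a != b))%:R.
  transitivity (\sum_i (i == a)%:R *
    ((a == a')%:R * \sum_k (k == b)%:R * ((b == b') && (i != k))%:R) : C).
    rewrite summxE; apply: eq_bigr => i _.
    rewrite summxE !mulr_sumr big_mkcond; apply: eq_bigr => k _.
    rewrite tensmxE !ketbraE !mxE /= !rmorph_nat -!natrM !mulnb.
    have [->|ia] := eqVneq a i; last by case: (i != k); rewrite ?[i == a]eq_sym ?(negPf ia).
    rewrite [b == k]eq_sym; have [->|kb] := eqVneq k b; last by case: (i != k); rewrite ?andbF.
    rewrite ?eqxx ![a' == _]eq_sym ![b' == _]eq_sym /=.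
    by case: (i != b); case: (i == a'); case: (b == b').
  by rewrite sum_delta_mul sum_delta_mul -natrM mulnb andbA.
rewrite phase_corrE [X in _ * X = _]mxE [X in _ * (X + _)]mxE [X in _ * (_ * X + _)]mxE.
rewrite [X in _ * (_ + X)]mxE flipE mxtens_index_eq.
have [/andP[/eqP <- /eqP <-]|n1] := boolP ((a == a') && (b == b')).
  rewrite [b == a]eq_sym andbb /=.
  have [<-|ab] := eqVneq a b; first by rewrite sign_corr_diag /=; ring.
  by rewrite sign_corr_same //=; ring.
have [/andP[/eqP ab /eqP ba]|n2] := boolP ((a == b') && (b == a')); last by rewrite /=; ring.
have ab' : a != b by move: n1; rewrite -ab -ba eq_sym andbb eq_sym.
by rewrite -ab -ba sign_corr_swap //=; ring.
Qed.

Lemma sepcone_dI_sub_flip : sepcone (d%:R *: 1%:M - F).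
Proof.
have p0 := phases_gt0.
have e : d%:R *: 1%:M - F =
    (2 * #|phases d|%:R : C)^-1 *: ((2 * #|phases d|%:R : C) *: (d%:R *: 1%:M - F)).
  by rewrite scalerA mulVf ?scale1r // mulf_neq0 ?(gt_eqF p0) ?pnatr_eq0.
have d1 : 0 <= d%:R - 1 :> C by rewrite subr_ge0 ler1n ltnW.
rewrite e dI_sub_flip_decomp; apply: sepconeZ.
  by rewrite invr_ge0 mulr_ge0 ?ler0n.
apply: sepconeD.
  by do 3!(apply: sepcone_sum => ? _); exact: sepcone_ketbra.
apply: sepconeZ; first by rewrite !mulr_ge0 ?ler0n.
by do 2!(apply: sepcone_sum => ? _); exact: sepcone_ketbra.
Qed.

End SeparableBuildingBlocks.

(** * Twirled states *)

Section TwirledStates.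
Context {R : realType}.
Local Notation C := R[i].
Variable (d : nat).
Local Notation F := (@flip R d).
Local Notation F1 := (regroupmx (F *t 1%:M)).
Local Notation F2 := (regroupmx (1%:M *t F)).
Local Notation F12 := (regroupmx (F *t F)).
Local Notation Q := (@swap_projs R d).
Local Notation e s := ((-1) ^+ (~~ s) : R).

Lemma sum_bool2 (V : nmodType) (f : bool * bool -> V) :
  \sum_st f st = f (true, true) + f (true, false) + (f (false, true) + f (false, false)).
Proof.
rewrite (eq_bigr (fun st => f (st.1, st.2))); last by case.
by rewrite -(pair_big xpredT xpredT (fun s t => f (s, t))) /= big_bool /= !big_bool.
Qed.

Lemma tensmx_lin2 n (I A : 'M[C]_n) (x y x' y' : C) :
  (x *: I + y *: A) *t (x' *: I + y' *: A) =
  (x * x') *: (I *t I) + (y * x') *: (A *t I) + (x * y') *: (I *t A) + (y * y') *: (A *t A).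
Proof. by apply/matrixP => i j; rewrite !mxE; ring. Qed.

Lemma regroupmx_lin4 m n (A B D E : 'M[C]_((m * n) * (m * n))) (x y z t : C) :
  regroupmx (x *: A + y *: B + z *: D + t *: E) =
  x *: regroupmx A + y *: regroupmx B + z *: regroupmx D + t *: regroupmx E.
Proof. by apply/matrixP => i j; rewrite !mxE. Qed.

Definition flip_comb (x y z t : R) : 'M[C]_((d * d) * (d * d)) :=
  x%:C *: 1%:M + y%:C *: F1 + z%:C *: F2 + t%:C *: F12.

Lemma flip_comb_eq x y z t x' y' z' t' : x = x' -> y = y' -> z = z' -> t = t' ->
  flip_comb x y z t = flip_comb x' y' z' t'.
Proof. by move=> -> -> -> ->. Qed.

Lemma flip_combD x y z t x' y' z' t' :
  flip_comb x y z t + flip_comb x' y' z' t'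
  = flip_comb (x + x') (y + y') (z + z') (t + t').
Proof.
rewrite /flip_comb !(rmorphD (real_complex R)) !scalerDl /=.
by rewrite [LHS]addrACA [X in X + _ = _]addrACA [X in X + _ + _ = _]addrACA.
Qed.

Lemma flip_combZ k x y z t :
  k%:C *: flip_comb x y z t = flip_comb (k * x) (k * y) (k * z) (k * t).
Proof. by rewrite /flip_comb !scalerDr !scalerA !(rmorphM (real_complex R)). Qed.

Lemma Re_mxtrace_flip_comb x y z t sigma :
  complex.Re (\tr (flip_comb x y z t *m sigma)) =
  x * complex.Re (\tr sigma) + y * complex.Re (\tr (F1 *m sigma))
  + z * complex.Re (\tr (F2 *m sigma)) + t * complex.Re (\tr (F12 *m sigma)).
Proof.
rewrite /flip_comb; move: (F1) (F2) (F12) => A B E.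
by rewrite !mulmxDl -!scalemxAl mul1mx !mxtraceD !mxtraceZ !Re_add !Re_mul_real.
Qed.

Lemma regroupmx_tens_flip (x y x' y' : R) :
  regroupmx ((x%:C *: 1%:M + y%:C *: F) *t (x'%:C *: 1%:M + y'%:C *: F)) =
  flip_comb (x * x') (y * x') (x * y') (y * y').
Proof.
rewrite tensmx_lin2 regroupmx_lin4 tensmx11 regroupmx1 /flip_comb.
by rewrite !(rmorphM (real_complex R)).
Qed.

Lemma swap_proj_flip r : swap_proj d r = (2^-1)%:C *: 1%:M + (e r / 2)%:C *: F.
Proof.
have half : 2^-1 = (2^-1)%:C :> C by rewrite (fmorphV (real_complex R)) rmorph_nat.
rewrite /swap_proj half; case: r; first by rewrite expr0 mul1r scalerDr.
by rewrite expr1 mulN1r (rmorphN (real_complex R)) scaleNr scalerBr.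
Qed.

Lemma swap_projsE s t : Q (s, t) = flip_comb 4^-1 (e s / 4) (e t / 4) (e s * e t / 4).
Proof.
rewrite /swap_projs !swap_proj_flip regroupmx_tens_flip.
have -> : 2^-1 * 2^-1 = 4^-1 :> R by field.
have -> (x : R) : x / 2 * 2^-1 = x / 4 by field.
have -> (x : R) : 2^-1 * (x / 2) = x / 4 by field.
by have -> (x y : R) : x / 2 * (y / 2) = x * y / 4 by field.
Qed.

(** A Walsh-Hadamard transform over the two signs passes from the projectors to the flips. *)
Lemma mixmx_swapE c : mixmx Q c = flip_comb
  ((c (true, true) + c (true, false) + (c (false, true) + c (false, false))) / 4)
  ((c (true, true) + c (true, false) - (c (false, true) + c (false, false))) / 4)
  ((c (true, true) - c (true, false) + (c (false, true) - c (false, false))) / 4)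
  ((c (true, true) - c (true, false) - (c (false, true) - c (false, false))) / 4).
Proof.
rewrite /mixmx sum_bool2 !swap_projsE !flip_combZ !flip_combD /= !expr0 !expr1.
move: (c (true, true)) (c (true, false)) (c (false, true)) (c (false, false)) => x y z t.
by apply: flip_comb_eq; field.
Qed.

Hypothesis d_gt1 : (1 < d)%N.
Local Notation D := (d%:R : R).

Lemma twirled_separable (x : R) (c : bool * bool -> R) : 0 <= x -> x <= 2^-1 ->
  (forall st, c st * complex.Re (\tr (Q st)) =
    match st with
    | (false, false) => (D - 1 - (D - 2) * x) / (2 * D)
    | (true, true) => (D + 1 - (D + 2) * x) / (2 * D)
    | _ => x / 2
    end) ->
  separable_state (m := d * d) (n := d * d) (mixmx Q c).
Proof.
move=> x0 x2 cE.
have D1 : 1 < D by rewrite ltr1n.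
have n0 : D != 0 by rewrite gt_eqF //; lra.
have n1 : D - 1 != 0 by rewrite gt_eqF //; lra.
have n2 : D + 1 != 0 by rewrite gt_eqF //; lra.
have cff : c (false, false) = (D - 1 - (D - 2) * x) / (2 * D) / (D * (D - 1) / 2) ^+ 2.
  have := cE (false, false); rewrite Re_mxtrace_swap_projs /= expr1 => <-.
  by field; rewrite n0 n1.
have ctt : c (true, true) = (D + 1 - (D + 2) * x) / (2 * D) / (D * (D + 1) / 2) ^+ 2.
  have := cE (true, true); rewrite Re_mxtrace_swap_projs /= expr0 => <-.
  by field; rewrite n0 n2.
have ctf : c (true, false) = x / 2 / (D * (D + 1) / 2 * (D * (D - 1) / 2)).
  have := cE (true, false); rewrite Re_mxtrace_swap_projs /= expr0 expr1 => <-.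
  by field; rewrite n0 n1 n2.
have cft : c (false, true) = x / 2 / (D * (D + 1) / 2 * (D * (D - 1) / 2)).
  have := cE (false, true); rewrite Re_mxtrace_swap_projs /= expr0 expr1 => <-.
  by field; rewrite n0 n1 n2.
(* The barycentric coordinates [1 - 2 x] and [2 x] on the segment between the two separable states,
   each divided by the trace of the unnormalised operator it multiplies. *)
pose t := (1 - 2 * x) / (D ^+ 3 * ((D - 1) * (D + 1))).
pose s := 2 * x / (D * ((D - 1) * (D + 1))) ^+ 2.
have fullE : @full_swap_op R d = flip_comb D (- 1) (- 1) D.
  rewrite /full_swap_op /flip_comb scalerDr rmorphN rmorph1 rmorph_nat !scaleN1r.
  by rewrite -!addrA; congr (_ + _); rewrite addrC -addrA.
have flipsE : regroupmx ((d%:R *: 1%:M - F) *t (d%:R *: 1%:M - F))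
    = flip_comb (D * D) (- 1 * D) (D * - 1) (- 1 * - 1).
  by rewrite -regroupmx_tens_flip rmorphN rmorph1 rmorph_nat scaleN1r.
have E : mixmx Q c = t%:C *: @full_swap_op R d
  + s%:C *: regroupmx ((d%:R *: 1%:M - F) *t (d%:R *: 1%:M - F)).
  rewrite mixmx_swapE fullE flipsE !flip_combZ flip_combD ctt ctf cft cff /t /s.
  by apply: flip_comb_eq; field; rewrite n0 n1 n2.
apply: sepcone_separable; rewrite ?muln_gt0 ?(ltnW d_gt1) //.
  rewrite E; apply: sepconeD; apply: sepconeZ.
  - rewrite ler0c divr_ge0 //; first lra.
    by rewrite mulr_ge0 ?exprn_ge0 ?mulr_ge0 //; lra.
  - exact: sepcone_full_swap_op.
  - rewrite ler0c divr_ge0 //; first lra.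
    by rewrite exprn_ge0 // ?mulr_ge0 //; lra.
  by apply: sepcone_regroup; exact: sepcone_dI_sub_flip.
have trR st : \tr (Q st) = (complex.Re (\tr (Q st)))%:C.
  by case: st => a b; rewrite mxtrace_regroup mxtrace_tens !mxtrace_swap_proj -rmorphM.
rewrite /mixmx mxtrace_sum.
transitivity ((\sum_st c st * complex.Re (\tr (Q st)))%:C).
  rewrite rmorph_sum /=; apply: eq_bigr => st _.
  by rewrite mxtraceZ rmorphM /= -trR.
rewrite (eq_bigr _ (fun st _ => cE st)) sum_bool2 -[RHS](rmorph1 (real_complex R)).
by congr (_%:C); field; rewrite n0.
Qed.

Definition swap_value (sigma : 'M[C]_((d * d) * (d * d))) (s t : bool) : R :=
  complex.Re (\tr (Q (s, t) *m sigma)).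

(** In terms of the flip expectations, the last expression is half the slack of
    [sepcone_flip_le]. *)
Lemma separable_swap_values (sigma : 'M[C]_((d * d) * (d * d)))
    (y := swap_value sigma) :
  separable_state sigma ->
  [/\ forall s t, 0 <= y s t,
      y true true = 1 - y false false - (y true false + y false true) &
      0 <= (D - 1) - 2 * D * y false false + (2 - D) * (y true false + y false true)].
Proof.
move=> sep; have cone := separable_sepcone sep.
have y0 s t : 0 <= y s t.
  move: cone => [K [v [w sE]]]; rewrite /y /swap_value sE mulmx_sumr mxtrace_sum Re_bigsum.
  apply: sumr_ge0 => k _; rewrite ketbra_tens mxtrace_ketbra.
  by have := (@swap_projs_psd R d (s, t)).2 (tensrow (v k) (w k)); rewrite lecE => /andP[].
pose f A := complex.Re (\tr (A *m sigma)).
have yE s t : y s t = (1 + e s * f F1 + e t * f F2 + e s * e t * f F12) / 4.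
  rewrite /y /swap_value swap_projsE Re_mxtrace_flip_comb (separable_state_trace sep).
  by rewrite /f; move: (e s) (e t) => a b /=; ring.
have wit : 2 * f F12 <= D * (f F1 + f F2).
  have := sepcone_flip_le cone; rewrite lecE => /andP[_].
  have nC (n : nat) : n%:R = n%:R%:C :> C by rewrite rmorph_nat.
  by rewrite !nC !Re_mul_real Re_add.
split => //.
  by rewrite !yE /= expr0 expr1; move: (f F1) (f F2) (f F12) => a b g; field.
rewrite !yE /= expr0 expr1.
move: (f F1) (f F2) (f F12) wit => a b g wit.
have -> : D - 1 - 2 * D * ((1 + -1 * a + -1 * b + -1 * -1 * g) / 4)
  + (2 - D) * ((1 + 1 * a + -1 * b + 1 * -1 * g) / 4 + (1 + -1 * a + 1 * b + -1 * 1 * g) / 4)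
  = (D * (a + b) - 2 * g) / 2 by field.
by rewrite divr_ge0 // subr_ge0.
Qed.

End TwirledStates.

(** * The entropy of entanglement *)

Section EntropyOfEntanglement.
Context {R : realType}.
Variables (d : nat) (eta : R).
Local Notation D := (d%:R : R).
Hypotheses (d_gt2 : 2 < D) (eta_ge : -1 <= eta) (eta_le : eta <= - (2 / D)).
Local Notation x0 := (werner_x0 D eta).
Local Notation x1 := (werner_x1 D eta).
Local Notation p0 := ((1 - eta) ^+ 2 / 4).
Local Notation p1 := ((1 - eta) * (1 + eta) / 2).
Local Notation p2 := ((1 + eta) ^+ 2 / 4).
Local Notation Q := (@swap_projs R d).
Local Notation q st := (complex.Re (\tr (Q st))).

Definition werner_coef (st : bool * bool) : R :=
  werner_weight d eta st.1 * werner_weight d eta st.2.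

(** Eigenvalues of the optimal separable state: the total weight on each projector over its rank. *)
Definition opt_coef (st : bool * bool) : R :=
  match st with
  | (false, false) => x0
  | (true, true) => 1 - x0 - x1
  | _ => x1 / 2
  end / q st.

Let d_gt1 : (1 < d)%N.
Proof. by rewrite -(ltr1n R); have := d_gt2; lra. Qed.

Let q_gt0 st : 0 < q st.
Proof.
have h := d_gt2; case: st => s t; rewrite Re_mxtrace_swap_projs.
by apply: mulr_gt0; apply: divr_gt0 => //; apply: mulr_gt0;
  case: s; case: t => /=; rewrite ?expr0 ?expr1; lra.
Qed.

Lemma werner_coef_mulq st : werner_coef st * q st =
  match st with
  | (false, false) => p0
  | (true, true) => p2
  | _ => p1 / 2
  end.
Proof.
have n0 : D != 0 by rewrite gt_eqF //; have := d_gt2; lra.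
have n1 : D - 1 != 0 by rewrite gt_eqF //; have := d_gt2; lra.
have n2 : D + 1 != 0 by rewrite gt_eqF //; have := d_gt2; lra.
by case: st => [[] []]; rewrite Re_mxtrace_swap_projs /werner_coef /werner_weight /=
  ?expr0 ?expr1 ?mul1r ?mulN1r; field; rewrite ?n0 ?n1 ?n2.
Qed.

Lemma opt_coef_mulq st : opt_coef st * q st =
  match st with
  | (false, false) => x0
  | (true, true) => 1 - x0 - x1
  | _ => x1 / 2
  end.
Proof. by rewrite /opt_coef divfK // gt_eqF. Qed.

Lemma werner_coefE st : werner_coef st =
  match st with
  | (false, false) => p0
  | (true, true) => p2
  | _ => p1 / 2
  end / q st.
Proof. by rewrite -werner_coef_mulq mulfK // gt_eqF. Qed.

Lemma werner_coef_ge0 st : 0 <= werner_coef st.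
Proof.
have h := weight1_ge0 d_gt2 eta_ge eta_le.
rewrite werner_coefE; apply: divr_ge0; last exact: ltW.
by case: st => [[] []]; apply: divr_ge0 => //; exact: sqr_ge0.
Qed.

(** Only the mixed weight [x1] can vanish, and it is positive whenever [p1] is. *)
Lemma opt_coef_gt0 st : 0 < werner_coef st -> 0 < opt_coef st.
Proof.
have h0 := werner_x0_gt0 d_gt2 eta_le.
have h2 := werner_x2_gt0 d_gt2 eta_le.
have h1 := werner_x1_gt0_weight1 d_gt2 eta_ge eta_le.
have half x : 0 < x / 2 -> 0 < x :> R by lra.
rewrite werner_coefE /opt_coef => h; apply: divr_gt0 => //; move: h.
rewrite pmulr_lgt0 ?invr_gt0 //.
by case: st => [[] []] // /half/h1 x1_gt0; apply: divr_gt0.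
Qed.

Lemma log2_ratioE st : werner_coef st * q st * (log2 (werner_coef st) - log2 (opt_coef st))
  = werner_coef st * q st * log2 (werner_coef st / opt_coef st).
Proof.
have [->|ne] := eqVneq (werner_coef st) 0; first by rewrite !mul0r.
have a0 : 0 < werner_coef st by rewrite lt_neqAle eq_sym ne werner_coef_ge0.
have c0 := opt_coef_gt0 a0.
by rewrite /log2 ln_div ?posrE // mulrBl.
Qed.

Lemma werner_div_optE st : werner_coef st / opt_coef st =
  match st with
  | (false, false) => p0 / x0
  | (true, true) => p2 / (1 - x0 - x1)
  | _ => p1 / x1
  end.
Proof.
have r x y z : z != 0 -> x / z / (y / z) = x / y :> R.
  by move=> z0; rewrite invfM invrK mulrACA mulVf // mulr1.
rewrite werner_coefE /opt_coef r ?gt_eqF //.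
by case: st => [[] []] //; rewrite r.
Qed.

Lemma opt_entropyE :
  \sum_st werner_coef st * q st * (log2 (werner_coef st) - log2 (opt_coef st)) =
  p0 * log2 (p0 / x0) + p1 * log2 (p1 / x1) + p2 * log2 (p2 / (1 - x0 - x1)).
Proof.
rewrite (eq_bigr _ (fun st _ => log2_ratioE st)) sum_bool2 !werner_coef_mulq !werner_div_optE.
move: (log2 (p0 / x0)) (log2 (p1 / x1)) (log2 (p2 / (1 - x0 - x1))) => a b c.
by field.
Qed.

Lemma werner_coef_sum : \sum_st werner_coef st * q st = 1.
Proof. by rewrite sum_bool2 !werner_coef_mulq; field. Qed.

Lemma opt_state_separable : separable_state (m := d * d) (n := d * d) (mixmx Q opt_coef).
Proof.
have h1 := werner_x1_ge0 d_gt2 eta_ge eta_le.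
have h2 := werner_x1_le d_gt2 eta_le.
apply: (twirled_separable d_gt1 h1 h2) => st; rewrite opt_coef_mulq.
have n0 : 2 * D != 0 by rewrite gt_eqF //; have := d_gt2; lra.
case: st => [[] []] //; apply: (mulIf n0); rewrite divfK // mulrC.
  by rewrite werner_x2E.
by rewrite werner_x0E.
Qed.

Lemma werner_relative_entropy_ge sigma :
  separable_state (m := d * d) (n := d * d) sigma ->
  ((p0 * log2 (p0 / x0) + p1 * log2 (p1 / x1) + p2 * log2 (p2 / (1 - x0 - x1)))%:E
    <= relative_entropy (mixmx Q werner_coef) sigma)%E.
Proof.
move=> sep; have [y0 ytt L0] := separable_swap_values sep.
rewrite -opt_entropyE; apply: relative_entropy_mixmx_ge.
- exact: swap_projs_psd.
- exact: swap_projs_orth.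
- exact: sepcone_psdmx (separable_sepcone sep).
- exact: werner_coef_ge0.
- exact: opt_coef_gt0.
- exact: werner_coef_sum.
(* The ranks cancel in the ratios, and both mixed terms carry [p1 / x1], so only the sum of the
   mixed values enters [werner_tangent_le1], as its [v]. *)
rewrite (eq_bigr (fun st : bool * bool => match st with
    | (false, false) => p0 / x0
    | (true, true) => p2 / (1 - x0 - x1)
    | _ => p1 / x1
    end * swap_value sigma st.1 st.2)); last by case=> s t _; rewrite werner_div_optE.
rewrite sum_bool2 /= ytt.
have v0 := addr_ge0 (y0 true false) (y0 false true).
have := werner_tangent_le1 d_gt2 eta_ge eta_le (y0 false false) v0 L0.
move: (swap_value sigma false false) (swap_value sigma true false)
  (swap_value sigma false true) => u v1 v2.
move: (p0 / x0) (p1 / x1) (p2 / (1 - x0 - x1)) => a b c.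
by apply: le_trans; rewrite le_eqVlt; apply/orP; left; apply/eqP; ring.
Qed.

Lemma werner_entanglement_relative_entropy :
  entanglement_relative_entropy (two_copies (werner eta d)) =
  (p0 * log2 (p0 / x0) + p1 * log2 (p1 / x1) + p2 * log2 (p2 / (1 - x0 - x1)))%:E.
Proof.
rewrite two_copies_werner // -/werner_coef /entanglement_relative_entropy.
apply/eqP; rewrite eq_le; apply/andP; split.
  apply: ereal_inf_lbound; exists (mixmx Q opt_coef); first exact: opt_state_separable.
  rewrite relative_entropy_mixmx ?opt_entropyE //.
  - exact: swap_projs_psd.
  - exact: swap_projs_orth.
  move=> st c0; apply/eqP; rewrite eq_le werner_coef_ge0 andbT leNgt.
  by apply/negP => /opt_coef_gt0; rewrite c0 ltxx.
by apply: le_ereal_inf_tmp => _ [sigma sep <-]; exact: werner_relative_entropy_ge.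
Qed.

End EntropyOfEntanglement.

Unset Implicit Arguments.
Local Close Scope complex_scope.
Local Close Scope sesquilinear_scope.

Theorem mainTheorem2 (R : realType) (d : nat) (eta : R)
    (hd : (2 < d)%N) (heta : -1 <= eta <= - (2 / d%:R)) :
  two_copy_entanglement_relative_entropy (m := d) (n := d) (werner eta d)
    = objective eta (werner_x0 d%:R eta) (werner_x1 d%:R eta)
  /\ feasible d%:R (werner_x0 d%:R eta) (werner_x1 d%:R eta)
  /\ (forall u v : R, feasible d%:R u v ->
        (objective eta (werner_x0 d%:R eta) (werner_x1 d%:R eta)
           <= objective eta u v)%E).
Proof.
have d2 : 2 < d%:R :> R by rewrite ltr_nat.
have /andP[e1 e2] := heta.
split; last by split; [exact: werner_feasible|exact: objective_opt_le].
rewrite /two_copy_entanglement_relative_entropy werner_entanglement_relative_entropy //.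
by rewrite objective_optE // -EFinM mulrC.
Qed.
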